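(* Let $u_1,u_2,u_3\in\mathbb{K}[T_1,T_2]$ be homogeneous of degree $d=2k+1>3$ without common factors, such that $\phi=(u_1:u_2:u_3)$ is a proper parameterization of a plane curve $C$ of degree $d$ that is parameterizable by conics and not by lines. Let $(F_1,F_2)$ be the pair of forms of degree $2$ in $\mathbb{K}[X_1,X_2,X_3]$ without common factors defining the inverse of $\phi$. In this case $\mathrm{Syz}(I)$ has a $\mathbb{K}[T_1,T_2]$-basis $\{p_{k,1}(T,X),q_{k+1,1}(T,X)\}$ with $T$-degrees $k$ and $k+1$ respectively. Set $P_k(T,X):=p_{k,1}(T,X)$ and, for $j=0,1,\ldots,k-1$, write (in any way, with bihomogeneous coefficients) $$P_{k-j}(T,X)=A_{k-j}(T,X)\,T_1+B_{k-j}(T,X)\,T_2$$ and set $$P_{k-j-1}(T,X):=A_{k-j}(T,X)\,F_1(X)+B_{k-j}(T,X)\,F_2(X).$$ Then $$J:=\{T_1F_2(X)-T_2F_1(X),\ q_{k+1,1}(T,X),\ P_0(T,X),\ldots,P_k(T,X)\}$$ is a minimal set of generators of the ideal $\mathcal{K}$.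
   Context: $\mathbb{K}$ is an algebraically closed field, $T=(T_1,T_2)$, $X=(X_1,X_2,X_3)$, $I=\langle u_1,u_2,u_3\rangle\subset\mathbb{K}[T]$. The ideal $\mathcal{K}\subset\mathbb{K}[T][X]$ is the kernel of the $\mathbb{K}[T]$-algebra morphism $\mathbb{K}[T][X]\to\mathrm{Rees}(I)=\mathbb{K}[T][IZ]$, $X_i\mapsto u_i(T)Z$ ($Z$ a new variable). It is bihomogeneous with respect to total degrees in $T$ and in $X$; a bihomogeneous $P$ of bidegree $(i,j)$ belongs to $\mathcal{K}_{i,j}$ iff $P(T,u(T))=0$. The piece $\mathcal{K}_{*,1}$ of $X$-degree $1$ is identified with the syzygy module $\mathrm{Syz}(I)$ via $aX_1+bX_2+cX_3\leftrightarrow(a,b,c)$; it is a free $\mathbb{K}[T]$-module of rank $2$. A plane curve $C$ is parameterizable by $(F_1,F_2)$ (homogeneous forms of the same degree without common factors) if $C\dashrightarrow\mathbb{P}^1$, $x\mapsto(F_1(x):F_2(x))$, is birational with inverse a map $\mathbb{P}^1\to C$ given by three homogeneous polynomials of the same degree without common factors; it is parameterizable by conics (resp. lines) if this holds for some such pair of degree $2$ (resp. $1$). A parameterization is proper if it is birational onto $C$. That $(F_1,F_2)$ defines the inverse of $\phi$ means $(F_1(u(T)):F_2(u(T)))=(T_1:T_2)$, i.e. $T_1F_2(X)-T_2F_1(X)\in\mathcal{K}$. *)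

(* Defs.v *)
From mathcomp Require Import all_boot all_algebra.
From mathcomp Require Import mpoly.

Set Implicit Arguments.
Unset Strict Implicit.
Unset Printing Implicit Defensive.

Import GRing.Theory.
Local Open Scope ring_scope.

Definition divides (A : comUnitRingType) (g f : A) : Prop :=
  exists h, f = h * g.

(* The zero tuple is excluded: all its entries are divisible by 0. *)
Definition no_common_factor (A : comUnitRingType) (m : nat) (f : m.-tuple A)
    : Prop :=
  forall g, (forall i, divides g (tnth f i)) -> g \is a GRing.unit.

Definition irreducible (A : comUnitRingType) (f : A) : Prop :=
  [/\ f != 0, f \isn't a GRing.unit &
      forall g h, f = g * h -> g \is a GRing.unit \/ h \is a GRing.unit].

Definition ideal_gen (A : comUnitRingType) (s : seq A) (x : A) : Prop :=
  exists c : 'I_(size s) -> A, x = \sum_i c i * s`_i.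

Definition minimal_generators (A : comUnitRingType) (s : seq A)
    (I : A -> Prop) : Prop :=
  (forall x, ideal_gen s x <-> I x) /\
  (forall s', subseq s' s -> (forall x, ideal_gen s' x <-> I x) -> s' = s).

(* Rational maps between integral projective varieties are given by tuples of
   forms of the same degree; the source is represented by its homogeneous prime
   ideal. For the projective line this ideal is 0, for the plane curve E = 0,
   with E irreducible, it is the principal ideal (E). *)

Definition forms (K : fieldType) (n m e : nat) (f : m.-tuple {mpoly K[n]})
    : Prop :=
  forall i, tnth f i \is e.-homog.

Definition coordinates (K : fieldType) (n : nat) : n.-tuple {mpoly K[n]} :=
  [tuple 'X_i | i < n].

Definition compose (K : fieldType) (n m l : nat)
    (g : l.-tuple {mpoly K[m]}) (f : m.-tuple {mpoly K[n]})
    : l.-tuple {mpoly K[n]} :=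
  [tuple tnth g i \mPo f | i < l].

Definition same_rational_map (K : fieldType) (n m : nat)
    (I : {mpoly K[n]} -> Prop) (f g : m.-tuple {mpoly K[n]}) : Prop :=
  [/\ exists i, ~ I (tnth f i),
      exists i, ~ I (tnth g i) &
      forall i j, I (tnth f i * tnth g j - tnth f j * tnth g i)].

Definition ideal_line (K : fieldType) (f : {mpoly K[2]}) : Prop := f = 0.

Definition ideal_curve (K : fieldType) (E : {mpoly K[3]})
    : {mpoly K[3]} -> Prop := divides E.

Definition plane_curve (K : fieldType) (d : nat) (E : {mpoly K[3]}) : Prop :=
  irreducible E /\ E \is d.-homog.

(* F : C --> P^1 and u : P^1 --> C are inverse to each other, C being E = 0. *)
Definition mutually_inverse (K : fieldType) (E : {mpoly K[3]})
    (F : 2.-tuple {mpoly K[3]}) (u : 3.-tuple {mpoly K[2]}) : Prop :=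
  [/\ E \mPo u = 0,
      same_rational_map (@ideal_line K) (compose F u) (coordinates K 2) &
      same_rational_map (ideal_curve E) (compose u F) (coordinates K 3)].

(* u is birational onto the curve E = 0. *)
Definition proper_parameterization (K : fieldType) (E : {mpoly K[3]})
    (u : 3.-tuple {mpoly K[2]}) : Prop :=
  exists (n : nat) (G : 2.-tuple {mpoly K[3]}),
    forms n G /\ mutually_inverse E G u.

Definition parameterizable_by (K : fieldType) (E : {mpoly K[3]})
    (F : 2.-tuple {mpoly K[3]}) : Prop :=
  exists (e : nat) (psi : 3.-tuple {mpoly K[2]}),
    [/\ forms e psi, no_common_factor psi & mutually_inverse E F psi].

Definition parameterizable_in_degree (K : fieldType) (n : nat)
    (E : {mpoly K[3]}) : Prop :=
  exists F : 2.-tuple {mpoly K[3]},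
    [/\ forms n F, no_common_factor F & parameterizable_by E F].

Definition parameterizable_by_lines (K : fieldType) (E : {mpoly K[3]}) : Prop :=
  parameterizable_in_degree 1 E.

Definition parameterizable_by_conics (K : fieldType) (E : {mpoly K[3]})
    : Prop :=
  parameterizable_in_degree 2 E.

(* (F_1(u(T)) : F_2(u(T))) = (T_1 : T_2) *)
Definition defines_inverse (K : fieldType) (F : 2.-tuple {mpoly K[3]})
    (u : 3.-tuple {mpoly K[2]}) : Prop :=
  same_rational_map (@ideal_line K) (compose F u) (coordinates K 2).

(* K[T][X] is {mpoly {mpoly K[2]}[3]}; the indices 0, 1 stand for T_1, T_2 and
   0, 1, 2 for X_1, X_2, X_3. *)

Definition varT (K : fieldType) (i : 'I_2) : {mpoly {mpoly K[2]}[3]} :=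
  ('X_i)%:MP.

Definition liftX (K : fieldType) (f : {mpoly K[3]}) : {mpoly {mpoly K[2]}[3]} :=
  map_mpoly (@mpolyC 2 K) f.

Definition bihomog (K : fieldType) (i j : nat) (P : {mpoly {mpoly K[2]}[3]})
    : Prop :=
  P \is j.-homog /\ forall m, P@_m \is i.-homog.

Definition bihomogeneous (K : fieldType) (P : {mpoly {mpoly K[2]}[3]}) : Prop :=
  exists i j, bihomog i j P.

(* The morphism X_i |-> u_i Z onto Rees(I), viewed in K[T][Z]. *)
Definition rees_map (K : fieldType) (u : 3.-tuple {mpoly K[2]})
    (P : {mpoly {mpoly K[2]}[3]}) : {poly {mpoly K[2]}} :=
  mmap (@polyC {mpoly K[2]}) (fun i => tnth u i *: 'X) P.

Definition rees_kernel (K : fieldType) (u : 3.-tuple {mpoly K[2]})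
    (P : {mpoly {mpoly K[2]}[3]}) : Prop :=
  rees_map u P = 0.

Definition syzygy (K : fieldType) (u : 3.-tuple {mpoly K[2]})
    (s : 'rV[{mpoly K[2]}]_3) : Prop :=
  \sum_i s 0 i * tnth u i = 0.

(* The identification of Syz(I) with the part of X-degree 1 of the kernel. *)
Definition syz_form (K : fieldType) (s : 'rV[{mpoly K[2]}]_3)
    : {mpoly {mpoly K[2]}[3]} :=
  \sum_i s 0 i *: 'X_i.

Definition syz_basis (K : fieldType) (u : 3.-tuple {mpoly K[2]})
    (p q : 'rV[{mpoly K[2]}]_3) : Prop :=
  [/\ syzygy u p, syzygy u q,
      forall s, syzygy u s -> exists a b : {mpoly K[2]}, s = a *: p + b *: q &
      forall a b : {mpoly K[2]}, a *: p + b *: q = 0 -> a = 0 /\ b = 0].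

Definition syz_homog (K : fieldType) (i : nat) (s : 'rV[{mpoly K[2]}]_3)
    : Prop :=
  forall l, s 0 l \is i.-homog.

(* Main.v *)
(* The substitution T = F(X) sends an element of the kernel of T-degree i to a
   multiple of the equation E of the curve, and by the regularity of F1, F2 its
   kernel on forms in T is generated by Q = T1 F2 - T2 F1. All the P_i have the
   same nonzero image, of degree d, hence E up to a constant: in T-degree i <= k
   the kernel is generated by Q and P_i. The same computation shows that there is
   no syzygy of degree less than k, which gives the degrees of the basis p, q.
   An element of T-degree at least k is brought into (p, q) by a power of some
   u_b, a product of linear forms L in T. If L G lies in (Q, p, q), reducing
   modulo L expresses G through an element of the kernel of T-degree exactly k, so
   G lies in (Q, p, q) too. Minimality follows by comparing bidegrees, since no P_i
   is a multiple of Q. *)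

From HB Require Import structures.
Require Import Defs.
From mathcomp Require Import all_boot all_algebra.
From mathcomp Require Import mpoly ring.
From mathcomp Require Import zify.

Set Implicit Arguments.
Unset Strict Implicit.
Unset Printing Implicit Defensive.

Import GRing.Theory.
Local Open Scope ring_scope.

(** * Greatest common divisors in polynomial rings *)

(** The substitution sends bidegree (i, j) to degree 2i + j. An element of T-degree i with image E
    therefore has X-degree d - 2i, and with d = 2k + 1 this is positive exactly when i <= k. Hence
    the threshold k: above it E has no preimage, and multiplication by linear forms has to take
    over. That a nonzero syzygy has a nonzero image is also a matter of degree, since Q has X-degree
    2 and the form of a syzygy has X-degree 1. Two facts on K[X] are needed: coprime F1, F2 form a
    regular sequence, and the irreducible E is prime. Both follow from the existence of gcds, which
    Gauss's lemma carries from a ring to polynomials over it. Algebraic closure enters through the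
    splitting of forms in two variables into linear factors. *)

Section Divisibility.

Context {A : comUnitRingType}.
Implicit Types a b c : A.

Lemma dividesxx a : divides a a.
Proof. by exists 1; rewrite mul1r. Qed.

Lemma divides0 a : divides a 0.
Proof. by exists 0; rewrite mul0r. Qed.

Lemma divides_trans a b c : divides a b -> divides b c -> divides a c.
Proof. by move=> [x ->] [y ->]; exists (y * x); rewrite mulrA. Qed.

Lemma divides_mull a b c : divides a b -> divides a (c * b).
Proof. by move=> [x ->]; exists (c * x); rewrite mulrA. Qed.

Lemma divides_mulr a b c : divides a b -> divides a (b * c).
Proof. by rewrite mulrC; apply: divides_mull. Qed.

Lemma dividesD a b c : divides a b -> divides a c -> divides a (b + c).
Proof. by move=> [x ->] [y ->]; exists (x + y); rewrite mulrDl. Qed.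

Lemma dividesN a b : divides a b -> divides a (- b).
Proof. by move=> [x ->]; exists (- x); rewrite mulNr. Qed.

Lemma dividesB a b c : divides a b -> divides a c -> divides a (b - c).
Proof. by move=> hb hc; apply: dividesD => //; apply: dividesN. Qed.

Lemma divides_mul a b c d : divides a b -> divides c d -> divides (a * c) (b * d).
Proof. by move=> [x ->] [y ->]; exists (x * y); rewrite mulrACA. Qed.

Lemma divides_unit a b c : a \is a GRing.unit -> divides b c -> divides (a * b) c.
Proof. by move=> ua [x ->]; exists (x * a^-1); rewrite mulrA mulrVK. Qed.

Lemma divides1_unit a : divides a 1 -> a \is a GRing.unit.
Proof. by move=> [x e]; apply/unitrP; exists x; rewrite -e mulrC -e. Qed.

End Divisibility.

Lemma divides_mul2l (D : idomainType) (c a b : D) :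
  c != 0 -> divides (c * a) (c * b) -> divides a b.
Proof.
move=> c0 [x e]; exists x; apply: (mulfI c0).
by rewrite e mulrCA.
Qed.

Section GcdDomain.

Context {D : idomainType}.
Implicit Types a b c : D.

Definition gcd_of a b g :=
  forall e, divides e g <-> (divides e a /\ divides e b).

(** This takes the place of unique factorization: it passes to polynomial rings and already makes
    irreducible elements prime. *)
Definition has_gcds := forall a b, exists g, gcd_of a b g.

Hypothesis gcdD : has_gcds.

(** The gcd of [a * c] and [b * c] is [c] times a common divisor of [a] and [b], so it is [c] up to
    a unit; and [b] divides it. *)
Lemma coprime_divides a b c : (forall e, divides e a -> divides e b ->
    e \is a GRing.unit) -> divides b (a * c) -> divides b c.
Proof.
move=> cop hb.
have [->|c0] := eqVneq c 0; first exact: divides0.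
have [g hg] := gcdD (a * c) (b * c).
have [w hw] : divides c g.
  by apply/hg; split; apply: divides_mull; apply: dividesxx.
have [[ga gb] _] := (hg g, hg g).
have [h1 h2] := (hg g).1 (dividesxx g).
have uw : w \is a GRing.unit.
  apply: cop; apply: (divides_mul2l c0).
    by rewrite mulrC [c * a]mulrC -hw.
  by rewrite mulrC [c * b]mulrC -hw.
have : divides b g by apply/hg; split=> //; apply: divides_mulr; apply: dividesxx.
case=> x e; exists (w^-1 * x).
by rewrite -mulrA -e hw mulKr.
Qed.

Lemma gcd_coprime a b : a != 0 -> exists g a' b',
  [/\ a = g * a', b = g * b', g != 0 &
      forall e, divides e a' -> divides e b' -> e \is a GRing.unit].
Proof.
move=> a0; have [g hg] := gcdD a b.
have [[a' ea] [b' eb]] := (hg g).1 (dividesxx g).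
have g0 : g != 0 by apply: contraNneq a0 => g0; rewrite ea g0 mulr0.
exists g, a', b'; rewrite ea eb ![g * _]mulrC; split=> // e he1 he2.
apply: divides1_unit; apply: (divides_mul2l g0); rewrite mulr1.
by apply/hg; rewrite ea eb; split; rewrite [_ * g]mulrC; apply: divides_mul;
  rewrite //; apply: dividesxx.
Qed.

Lemma dividesCP c (p : {poly D}) :
  divides c%:P p <-> forall i, divides c p`_i.
Proof.
split=> [[q ->] i|]; first by rewrite coefMC; exists q`_i.
elim/poly_ind: p => [|p a IH] h; first exact: divides0.
apply: dividesD.
  apply: divides_mulr; apply: IH => i.
  by have := h i.+1; rewrite coefD coefMX coefC addr0.
have := h 0; rewrite coefD coefMX coefC add0r => -[x ->].
by exists x%:P; rewrite polyCM.
Qed.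

Definition primitive (p : {poly D}) :=
  forall c, divides c%:P p -> c \is a GRing.unit.

Lemma contentP (p : {poly D}) : exists g, forall e,
  divides e g <-> divides e%:P p.
Proof.
elim/poly_ind: p => [|p a [g hg]].
  by exists 0 => e; split=> _; apply: divides0.
have [g' hg'] := gcdD a g; exists g' => e; rewrite hg' hg !dividesCP.
split=> [[ha hp] [|i]|h].
- by rewrite coefD coefMX coefC add0r.
- by rewrite coefD coefMX coefC addr0.
split; first by have := h 0; rewrite coefD coefMX coefC add0r.
by move=> i; have := h i.+1; rewrite coefD coefMX coefC addr0.
Qed.

Lemma primitive_part (p : {poly D}) : p != 0 ->
  exists c p0, [/\ p = c%:P * p0, c != 0 & primitive p0].
Proof.
move=> p0; have [g hg] := contentP p.
have [q eq] : divides g%:P p by apply/hg; apply: dividesxx.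
have g0 : g != 0 by apply: contraNneq p0 => g0; rewrite eq g0 mulr0.
exists g, q; rewrite mulrC; split=> // c [r hr].
apply: divides1_unit; apply: (divides_mul2l g0); rewrite mulr1.
apply/hg; exists r; rewrite eq hr polyCM; ring.
Qed.

Lemma primitive_neq0 (p : {poly D}) : primitive p -> p != 0.
Proof.
move=> pp; apply/eqP => p0; have := pp 0; rewrite p0 unitr0 => h.
by have := h (divides0 _).
Qed.

(* If [c] divides [a f] with [a] primitive, its gcd with the leading
   coefficient of [a] splits [c] into a factor that divides the leading
   coefficient of [f] and one that divides that of [a]; both leading terms can
   then be removed. *)
Lemma primitive_divides_mul c (a f : {poly D}) :
  primitive a -> divides c%:P (a * f) -> divides c%:P f.
Proof.
elim: {a f}_.+1 {-2}a {-2}f c (ltnSn (size a + size f)) => // n IH a f c.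
move=> size_af pa; have a0 := primitive_neq0 pa.
have [->|f0 hc] := eqVneq f 0; first by move=> _; apply: divides0.
have la0 : lead_coef a != 0 by rewrite lead_coef_eq0.
have size_tail (g : {poly D}) : g != 0 ->
    (size (g - (lead_coef g)%:P * 'X^((size g).-1))%R < size g)%N.
  move=> g0; rewrite -[X in (_ < X)%N](@prednK (size g)) ?size_poly_gt0 //.
  rewrite ltnS; apply/leq_sizeP => j; rewrite leq_eqVlt => /orP [/eqP <-|hj].
    by rewrite coefB coefCM coefXn eqxx mulr1 subrr.
  rewrite coefB coefCM coefXn gtn_eqF // mulr0 subr0 nth_default //.
  by rewrite -(@prednK (size g)) ?size_poly_gt0.
have [g [la' [c' [ela ec g0 cop]]]] := gcd_coprime c la0.
have hlf : divides c' (lead_coef f).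
  apply: (coprime_divides cop); apply: (divides_mul2l g0); rewrite mulrA -ela -ec.
  by rewrite -lead_coefM lead_coefE; have /dividesCP := hc; apply.
have : divides c'%:P f.
  rewrite -[f](subrK ((lead_coef f)%:P * 'X^((size f).-1))).
  have hX : divides c'%:P ((lead_coef f)%:P * 'X^((size f).-1)).
    apply: divides_mulr; case: hlf => x ->; exists x%:P; exact: polyCM.
  apply: dividesD => //; apply: (IH a) => //.
    by apply: leq_trans (_ : size a + size f <= n)%N; rewrite ?ltn_add2l ?size_tail.
  rewrite mulrBr; apply: dividesB; last exact: divides_mull.
  apply: divides_trans hc; exists g%:P; by rewrite ec polyCM.
move=> [f' ef].
have c'0 : c'%:P != 0 by apply: contraNneq f0 => e; rewrite ef e mulr0.
have size_f' : size f' = size f.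
  by rewrite ef mulrC size_Cmul //; apply: contraNneq c'0 => ->.
have hg : divides g%:P (a * f').
  apply: (divides_mul2l c'0); rewrite -polyCM mulrC -ec.
  by rewrite mulrCA [_ * f']mulrC -ef.
suff [x hx] : divides g%:P f' by exists x; rewrite ef hx ec polyCM; ring.
set a1 := a - (lead_coef a)%:P * 'X^((size a).-1).
have ea1 : a = a1 + (lead_coef a)%:P * 'X^((size a).-1) by rewrite subrK.
have hgX : divides g%:P ((lead_coef a)%:P * 'X^((size a).-1)).
  by apply: divides_mulr; exists la'%:P; rewrite ela mulrC polyCM.
have [a10|a10] := eqVneq a1 0.
  have ug : g \is a GRing.unit by apply: pa; rewrite ea1 a10 add0r.
  by exists (g^-1%:P * f'); rewrite mulrAC -polyCM mulVr // mul1r.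
have [b [a2 [ea2 b0 pa2]]] := primitive_part a10.
have size_a2 : size a2 = size a1 by rewrite ea2 size_Cmul.
(* A common divisor of [g] and the content [b] of [a1] divides both parts of [a], so it is a unit.
   Up to that unit [g] is coprime to [b], and the primitive part [a2] can replace [a1]. *)
have [r [b' [g' [eb eg r0 cop']]]] := gcd_coprime g b0.
have ur : r \is a GRing.unit.
  apply: pa; rewrite ea1; apply: dividesD.
    by exists (b'%:P * a2); rewrite ea2 eb polyCM; ring.
  by apply: divides_trans hgX; exists g'%:P; rewrite eg polyCM; ring.
have hg' : divides g'%:P (a2 * f').
  have : divides g%:P (a1 * f').
    by rewrite mulrBl; apply: dividesB => //; apply: divides_mulr.
  rewrite ea2 eb eg !polyCM -!mulrA => h'.
  have /dividesCP h : divides g'%:P (b'%:P * (a2 * f')).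
    by apply: divides_mul2l h'; rewrite polyC_eq0.
  apply/dividesCP => i; apply: (coprime_divides cop').
  by rewrite -coefCM.
have : divides g'%:P f'.
  apply: (IH a2) => //; rewrite size_a2 size_f'; have := size_tail a a0.
  rewrite -/a1; lia.
by rewrite eg polyCM; apply: divides_unit; rewrite poly_unitE size_polyC coefC r0.
Qed.

(** In [c * f = h * b] the constant [c] divides [h] by Gauss's lemma, because [b] is primitive, and
    can be cancelled. *)
Lemma primitive_dividesC c (b f : {poly D}) :
  primitive b -> c != 0 -> divides b (c%:P * f) -> divides b f.
Proof.
move=> pb c0 [h e].
have [x ex] : divides c%:P h.
  apply: (primitive_divides_mul pb); rewrite mulrC -e.
  by apply: divides_mulr; apply: dividesxx.
by exists x; apply: (@mulfI _ c%:P); rewrite ?polyC_eq0 // e ex; ring.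
Qed.

(** Bézout over the fraction field, with denominators cleared. A nonzero pseudo-remainder of [a] or
    [b] by a combination is a smaller combination, so the descent stops at one that divides constant
    multiples of both. *)
Lemma bezout_pseudo (a b : {poly D}) : a != 0 -> exists s t c d,
  [/\ s * a + t * b != 0, c != 0, d != 0, divides (s * a + t * b) (c%:P * a)
    & divides (s * a + t * b) (d%:P * b)].
Proof.
move=> a0.
suff descent n : forall s t : {poly D}, s * a + t * b != 0 ->
    (size (s * a + t * b)%R < n)%N -> exists s t c d,
    [/\ s * a + t * b != 0, c != 0, d != 0, divides (s * a + t * b) (c%:P * a)
      & divides (s * a + t * b) (d%:P * b)].
  by apply: (descent (size a).+1 1 0); rewrite mul1r mul0r addr0.
elim: n => // n IH s t; set g := s * a + t * b => g0 size_g.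
have lg0 : lead_coef g != 0 by rewrite lead_coef_eq0.
have [ea eb] := (Pdiv.Idomain.divp_eq a g, Pdiv.Idomain.divp_eq b g).
have [ra0|ra0] := eqVneq (a %% g)%R 0; last first.
  have er : a %% g = ((lead_coef g ^+ scalp a g)%:P - (a %/ g) * s) * a
      + (- (a %/ g) * t) * b.
    have -> : a %% g = lead_coef g ^+ scalp a g *: a - (a %/ g) * g.
      by rewrite ea addrAC subrr add0r.
    rewrite -mul_polyC /g; ring.
  rewrite er in ra0; apply: IH ra0 _; rewrite -er.
  by apply: leq_trans (size_g : size g <= n)%N; rewrite ltn_modp.
have [rb0|rb0] := eqVneq (b %% g)%R 0; last first.
  have er : b %% g = (- (b %/ g) * s) * a
      + ((lead_coef g ^+ scalp b g)%:P - (b %/ g) * t) * b.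
    have -> : b %% g = lead_coef g ^+ scalp b g *: b - (b %/ g) * g.
      by rewrite eb addrAC subrr add0r.
    rewrite -mul_polyC /g; ring.
  rewrite er in rb0; apply: IH rb0 _; rewrite -er.
  by apply: leq_trans (size_g : size g <= n)%N; rewrite ltn_modp.
exists s, t, (lead_coef g ^+ scalp a g), (lead_coef g ^+ scalp b g).
split; rewrite ?expf_neq0 // mul_polyC.
  by rewrite ea ra0 addr0; exists (a %/ g).
by rewrite eb rb0 addr0; exists (b %/ g).
Qed.

End GcdDomain.

Arguments has_gcds : clear implicits.

(** The gcd is the primitive part [g] of a Bézout combination times the gcd [w] of the contents of
    the cofactors [a'], [b']. For a common divisor, its primitive part divides [g] and its content
    divides both of these contents, again by Gauss's lemma. *)
Lemma has_gcds_poly (D : idomainType) : has_gcds D -> has_gcds {poly D}.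
Proof.
move=> gcdD a b.
have [->|a0] := eqVneq a 0.
  by exists b => e; split=> [h|[]] //; split=> //; apply: divides0.
have [s [t [c [d [g0 c0 d0 ha hb]]]]] := bezout_pseudo b a0.
have [l [g [eg l0 pg]]] := primitive_part gcdD g0.
have hg : divides g (s * a + t * b) by exists l%:P.
have [a' ea] := primitive_dividesC gcdD pg c0 (divides_trans hg ha).
have [b' eb] := primitive_dividesC gcdD pg d0 (divides_trans hg hb).
have [[u hu] [v hv]] := (contentP gcdD a', contentP gcdD b').
have [w hw] := gcdD u v.
exists (w%:P * g) => e; split=> [h|[hea heb]].
  have [/hu wa /hv wb] := (hw w).1 (dividesxx w).
  by split; apply: (divides_trans h); rewrite ?ea ?eb; apply: divides_mul => //;
    apply: dividesxx.
have e0 : e != 0.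
  by apply: contraNneq a0 => e0; case: hea => x ->; rewrite e0 mulr0.
have [f [e1 [ee f0 pe1]]] := primitive_part gcdD e0.
have he1 : divides e1 e by exists f%:P.
have [g' eg'] : divides e1 g.
  apply: (primitive_dividesC gcdD pe1 l0); rewrite -eg.
  by apply: (divides_trans he1); apply: dividesD; apply: divides_mull.
have pg' : primitive g'.
  by move=> x hx; apply: pg; rewrite eg'; apply: divides_mulr.
have e10 := primitive_neq0 pe1.
have hf (x x' : {poly D}) : divides e x -> x = x' * g -> divides f%:P x'.
  move=> hx ex; apply: (primitive_divides_mul gcdD pg').
  apply: (divides_mul2l e10); move: hx; rewrite ee ex eg'.
  by rewrite [f%:P * _]mulrC mulrA [_ * e1]mulrC [x' * g']mulrC.
rewrite ee eg' mulrCA; apply: divides_mull.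
apply: divides_mul; last exact: dividesxx.
apply/dividesCP => i; rewrite coefC; case: eqP => _; last exact: divides0.
by apply/hw; split; [apply/hu; apply: hf hea ea|apply/hv; apply: hf heb eb].
Qed.

Lemma has_gcds_iso (A B : idomainType) (f : {rmorphism A -> B})
    (g : {rmorphism B -> A}) :
  cancel f g -> cancel g f -> has_gcds B -> has_gcds A.
Proof.
move=> fK gK gcdB a b; have [c hc] := gcdB (f a) (f b).
have dvd_f x y : divides x y <-> divides (f x) (f y).
  split=> -[z e]; first by exists (f z); rewrite e rmorphM.
  by exists (g z); rewrite -[y]fK e rmorphM /= fK.
by exists (g c) => e; rewrite !dvd_f gK hc.
Qed.

Lemma has_gcds_field (K : fieldType) : has_gcds K.
Proof.
move=> a b; have [->|a0] := eqVneq a 0.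
  by exists b => e; split=> [h|[]] //; split=> //; apply: divides0.
exists 1 => e; split=> [/divides1_unit ue|[[x ex] _]].
  by split; [exists (a / e)|exists (b / e)]; rewrite mulrVK.
have e0 : e != 0 by apply: contraNneq a0 => e0; rewrite ex e0 mulr0.
by exists e^-1; rewrite mulVf.
Qed.

(** [I] is an ideal given as a predicate. It will be zero, the multiples of a linear form, the
    multiples of [E], and the ideal spanned by three elements. *)
Lemma rmorph_congr (R : nzRingType) (n : nat) (A : comNzRingType) (I : A -> Prop)
    (f g : {rmorphism {mpoly R[n]} -> A}) :
  I 0 -> (forall x y, I x -> I y -> I (x + y)) -> (forall a x, I x -> I (a * x)) ->
  (forall c, I (f c%:MP - g c%:MP)) -> (forall i, I (f 'X_i - g 'X_i)) ->
  forall p, I (f p - g p).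
Proof.
move=> I0 ID IM hC hX.
have hM x y : I (f x - g x) -> I (f y - g y) -> I (f (x * y) - g (x * y)).
  move=> hx hy; rewrite !rmorphM.
  have -> : f x * f y - g x * g y = f x * (f y - g y) + g y * (f x - g x) by ring.
  by apply: ID; apply: IM.
elim/mpolyind => [|c m p _ _ IH]; first by rewrite !rmorph0 subrr.
rewrite !rmorphD /= opprD addrACA; apply: ID => //.
rewrite -mul_mpolyC; apply: (hM) => //; rewrite mpolyXE_id.
apply: (big_ind (fun x => I (f x - g x))) => [|x y|i _];
  [by rewrite !rmorph1 subrr|exact: (hM)|].
elim: (m i) => [|e IHe]; first by rewrite !expr0 !rmorph1 subrr.
by rewrite exprS; apply: hM.
Qed.

Lemma eq_rmorph_mpoly (R : nzRingType) (n : nat) (A : comNzRingType)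
    (f g : {rmorphism {mpoly R[n]} -> A}) :
  (forall c, f c%:MP = g c%:MP) -> (forall i, f 'X_i = g 'X_i) -> f =1 g.
Proof.
move=> hC hX p; apply/eqP; rewrite -subr_eq0; apply/eqP.
apply: (@rmorph_congr _ _ _ (fun x => x = 0)) => //.
- by move=> x y -> ->; rewrite addr0.
- by move=> a x ->; rewrite mulr0.
- by move=> c; rewrite hC subrr.
- by move=> i; rewrite hX subrr.
Qed.

(** Induction on the number of variables: [f] and [g] are the inverse isomorphisms that make
    ['X_ord_max] the variable of univariate polynomials over the remaining ones. *)
Lemma has_gcds_mpoly (K : fieldType) (n : nat) : has_gcds {mpoly K[n]}.
Proof.
elim: n => [|n IH].
  apply: (@has_gcds_iso _ _ (@mcoeff 0 K 0%MM) (@mpolyC 0 K)).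
  - by move=> p; apply/esym/nvar0_mpolyC.
  - by move=> c; rewrite /= mcoeffC eqxx mulr1.
  - exact: has_gcds_field.
pose h (i : 'I_n.+1) : {poly {mpoly K[n]}} :=
  if unlift ord_max i is Some j then ('X_j)%:P else 'X.
pose f : {rmorphism {mpoly K[n.+1]} -> {poly {mpoly K[n]}}} :=
  mmap (polyC \o @mpolyC n K) h.
pose w : {rmorphism {mpoly K[n]} -> {mpoly K[n.+1]}} :=
  mmap (@mpolyC n.+1 K) (fun j => 'X_(lift ord_max j)).
pose g : {rmorphism {poly {mpoly K[n]}} -> {mpoly K[n.+1]}} :=
  horner_eval ('X_ord_max : {mpoly K[n.+1]}) \o map_poly w.
have gC c : g c%:P = w c by rewrite /= map_polyC /= /horner_eval hornerC.
have gX : g 'X = 'X_ord_max by rewrite /= map_polyX /horner_eval hornerX.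
have fC c : f c%:MP = (c%:MP)%:P by rewrite /= mmapC.
have fX i : f 'X_i = h i by rewrite /= mmapX mmap1U.
have wC c : w c%:MP = c%:MP by rewrite /= mmapC.
have wX j : w 'X_j = 'X_(lift ord_max j) by rewrite /= mmapX mmap1U.
have gh i : g (h i) = 'X_i.
  by rewrite /h; case: unliftP => [j ->|-> //]; rewrite gC wX.
apply: (@has_gcds_iso _ _ f g _ _ (has_gcds_poly IH)).
  apply: (@eq_rmorph_mpoly _ _ _ (g \o f) idfun) => [c|i].
    exact: etrans (congr1 g (fC c)) (etrans (gC _) (wC c)).
  exact: etrans (congr1 g (fX i)) (gh i).
have fw c : f (w c) = c%:P.
  move: c; apply: (@eq_rmorph_mpoly _ _ _ (f \o w) polyC) => [c|i].
    exact: etrans (congr1 f (wC c)) (fC c).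
  by apply: (etrans (congr1 f (wX i))); rewrite fX /h liftK.
elim/poly_ind => [|p c IHp].
  exact: etrans (congr1 f (rmorph0 g)) (rmorph0 f).
apply: (etrans (congr1 f (rmorphD g _ _))); apply: (etrans (rmorphD f _ _)).
congr (_ + _); last exact: etrans (congr1 f (gC c)) (fw c).
apply: (etrans (congr1 f (rmorphM g _ _))); apply: (etrans (rmorphM f _ _)).
congr (_ * _) => //; apply: (etrans (congr1 f gX)).
by rewrite fX /h unlift_none.
Qed.

Lemma irreducible_prime (D : idomainType) (p a b : D) : has_gcds D ->
  irreducible p -> divides p (a * b) -> divides p a \/ divides p b.
Proof.
move=> gcdD [p0 _ irr] hab.
have [g hg] := gcdD a p; have [ha [q eq]] := (hg g).1 (dividesxx g).
case: (irr _ _ eq) => [/unitrP [x [ex _]]|ug].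
  left; apply: divides_trans ha; exists x; by rewrite eq mulrA ex mul1r.
right; apply: (coprime_divides gcdD _ hab) => e hea hep.
have [y ey] : divides e g by apply/hg.
by apply: divides1_unit; exists (g^-1 * y); rewrite -mulrA -ey mulVr.
Qed.

(** * Forms, coefficient degrees and linear forms *)

Section Homogeneous.

Context {n : nat}.

Lemma mmap_homogZ (R : nzRingType) (A : comNzRingType) (f : {additive R -> A})
    (h : 'I_n -> A) c e (p : {mpoly R[n]}) :
  p \is e.-homog -> mmap f (fun i => c * h i) p = c ^+ e * mmap f h p.
Proof.
move=> /dhomogP hp; rewrite /mmap mulr_sumr; apply: eq_big_seq => m hm.
rewrite mulrCA; congr (_ * _).
rewrite /mmap1 (eq_bigr (fun i => c ^+ m i * h i ^+ m i)); last first.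
  by move=> i _; rewrite exprMn.
by rewrite big_split /= prodrXr -mdegE hp.
Qed.

Lemma mcoeff_pihomog (R : nzRingType) i (p : {mpoly R[n]}) m :
  (pihomog mdeg i p)@_m = if mdeg m == i then p@_m else 0.
Proof.
case: eqP => [hm|/eqP hm]; last first.
  exact: dhomog_nemf_coeff (pihomogP _ _ _) hm.
elim/mpolyind: p => [|c m' p _ _ IH]; first by rewrite pihomog0.
rewrite pihomogD linearZ /= !mcoeffD IH !mcoeffZ pihomogX mcoeffX /=.
case: (eqVneq m' m) => [->|hm']; first by rewrite hm eqxx mcoeffX eqxx.
by case: eqP => _; rewrite ?mcoeffX ?(negbTE hm') ?mcoeff0.
Qed.

Lemma pihomogM (R : comNzRingType) i e (f g : {mpoly R[n]}) :
  g \is e.-homog -> pihomog mdeg (i + e) (f * g) = pihomog mdeg i f * g.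
Proof.
move=> hg; elim/mpolyind: f => [|c m p _ _ IH].
  by rewrite mul0r !pihomog0 mul0r.
rewrite mulrDl !pihomogD IH mulrDl -scalerAl !linearZ /= -scalerAl pihomogX.
congr (_ *: _ + _); have hX : 'X_[m] * g \is (mdeg m + e).-homog.
  by apply: dhomogM => //; rewrite dhomogX.
case: eqP => [<-|/eqP hm]; first by rewrite pihomog_dE.
by rewrite mul0r; apply: pihomog_ne0 hX; rewrite eqn_add2r.
Qed.

Lemma pihomogM_lt (R : comNzRingType) i e (f g : {mpoly R[n]}) :
  g \is e.-homog -> (i < e)%N -> pihomog mdeg i (f * g) = 0.
Proof.
move=> hg hi; elim/mpolyind: f => [|c m p _ _ IH].
  by rewrite mul0r pihomog0.
rewrite mulrDl pihomogD IH -scalerAl linearZ /= addr0.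
have hX : 'X_[m] * g \is (mdeg m + e).-homog.
  by apply: dhomogM => //; rewrite dhomogX.
by rewrite (pihomog_ne0 _ hX) ?scaler0 //; apply/eqP; lia.
Qed.

Lemma homog0_const (R : nzRingType) (p : {mpoly R[n]}) :
  p \is 0.-homog -> p = (p@_0%MM)%:MP.
Proof.
move=> hp; apply/mpolyP => m; rewrite mcoeffC.
have [->|hm] := eqVneq 0%MM m; first by rewrite mulr1.
by rewrite mulr0; apply: dhomog_nemf_coeff hp _; rewrite mdeg_eq0 eq_sym.
Qed.

End Homogeneous.

Section CoefHomogeneous.

Context {n l : nat} {R : comNzRingType}.
Implicit Types P : {mpoly {mpoly R[n]}[l]}.

(** For K[T][X] this is homogeneity in [T] alone; the polynomial may mix degrees in [X]. *)
Definition coef_homog i P := forall m, P@_m \is i.-homog.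

Definition coef_pihomog i P := map_mpoly (pihomog mdeg i) P.

Lemma mcoeff_coef_pihomog i P m : (coef_pihomog i P)@_m = pihomog mdeg i P@_m.
Proof. by rewrite mcoeff_map_mpoly. Qed.

Lemma coef_pihomogD i P Q :
  coef_pihomog i (P + Q) = coef_pihomog i P + coef_pihomog i Q.
Proof. exact: raddfD. Qed.

Lemma coef_pihomogP i P : coef_homog i (coef_pihomog i P).
Proof. by move=> m; rewrite mcoeff_coef_pihomog pihomogP. Qed.

Lemma coef_pihomog_dE i P : coef_homog i P -> coef_pihomog i P = P.
Proof.
by move=> hP; apply/mpolyP => m; rewrite mcoeff_coef_pihomog pihomog_dE.
Qed.

Lemma coef_pihomogM i e P Q : coef_homog e Q ->
  coef_pihomog (i + e) (P * Q) = coef_pihomog i P * Q.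
Proof.
move=> hQ; apply/mpolyP => m; rewrite mcoeff_coef_pihomog !mcoeffM raddf_sum.
by apply: eq_bigr => j _; rewrite /= pihomogM // mcoeff_coef_pihomog.
Qed.

Lemma coef_pihomogM_lt i e P Q : coef_homog e Q -> (i < e)%N ->
  coef_pihomog i (P * Q) = 0.
Proof.
move=> hQ hi; apply/mpolyP => m; rewrite mcoeff_coef_pihomog mcoeffM raddf_sum.
by rewrite mcoeff0 big1 // => j _; rewrite /= (pihomogM_lt _ (hQ _)).
Qed.

Lemma coef_homogD i P Q : coef_homog i P -> coef_homog i Q -> coef_homog i (P + Q).
Proof. by move=> hP hQ m; rewrite mcoeffD dhomogD. Qed.

Lemma coef_homogN i P : coef_homog i P -> coef_homog i (- P).
Proof. by move=> hP m; rewrite mcoeffN dhomogN. Qed.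

Lemma coef_homogM i j P Q : coef_homog i P -> coef_homog j Q ->
  coef_homog (i + j) (P * Q).
Proof.
move=> hP hQ m; rewrite mcoeffM; apply: rpred_sum => k _.
exact: dhomogM.
Qed.

Lemma coef_homogC i c : c \is i.-homog -> coef_homog i c%:MP_[l].
Proof.
move=> hc m; rewrite mcoeffC; case: eqP => _.
  by rewrite mulr1.
by rewrite mulr0 dhomog0.
Qed.

Lemma coef_homogX i c : coef_homog i c -> forall e, coef_homog (i * e) (c ^+ e).
Proof.
move=> hc; elim=> [|e IH]; last by rewrite exprS mulnS; apply: coef_homogM.
by rewrite muln0 expr0 -mpolyC1; apply: coef_homogC; apply: dhomog1.
Qed.

Lemma coef_pihomog_homog i j P : P \is j.-homog -> coef_pihomog i P \is j.-homog.
Proof.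
move=> hP; apply/dhomogP => m; rewrite mcoeff_msupp mcoeff_coef_pihomog => hm.
apply/eqP; apply: contraNT hm => hm.
by rewrite (dhomog_nemf_coeff hP hm) pihomog0.
Qed.

Lemma pihomog_coef_homog i j P : coef_homog i P -> coef_homog i (pihomog mdeg j P).
Proof. by move=> hP m; rewrite mcoeff_pihomog; case: ifP => _ //; apply: dhomog0. Qed.

End CoefHomogeneous.

Section LinearForms.

Context {K : fieldType}.

Lemma ord2_ind (P : 'I_2 -> Prop) : P 0 -> P 1 -> forall i, P i.
Proof.
move=> P0 P1 [[|[|i]] hi] //.
  by rewrite (_ : Ordinal hi = 0) //; apply: val_inj.
by rewrite (_ : Ordinal hi = 1) //; apply: val_inj.
Qed.

(** The form that vanishes at the point [(z 0 : z 1)] of the projective line. *)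
Definition linform (z : 'I_2 -> K) : {mpoly K[2]} := z 1 *: 'X_0 - z 0 *: 'X_1.

(* Reduction modulo [linform z], for a point [z] normalized by [z c = 1]. *)
Definition reduce (c : 'I_2) (z : 'I_2 -> K) : {mpoly K[2]} -> {mpoly K[2]} :=
  mmap (@mpolyC 2 K) (fun i => z i *: 'X_c).

HB.instance Definition _ c z := GRing.RMorphism.copy (reduce c z)
  (mmap (@mpolyC 2 K) (fun i => z i *: 'X_c)).

Lemma reduceC c z a : reduce c z a%:MP = a%:MP.
Proof. by rewrite /reduce mmapC. Qed.

Lemma reduceX c z i : reduce c z 'X_i = z i *: 'X_c.
Proof. by rewrite /reduce mmapX mmap1U. Qed.

Lemma reduceZ c z a f : reduce c z (a *: f) = a *: reduce c z f.
Proof. by rewrite -mul_mpolyC rmorphM /= reduceC mul_mpolyC. Qed.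

Lemma reduce_linform c z : reduce c z (linform z) = 0.
Proof.
by rewrite /linform rmorphB /= !reduceZ !reduceX !scalerA mulrC subrr.
Qed.

Lemma linform_homog z : linform z \is 1.-homog.
Proof. by apply: rpredB; apply: rpredZ; rewrite dhomogX /= mdeg1. Qed.

Lemma linform_neq0 c z : z c = 1 -> linform z != 0.
Proof.
move=> hz; apply/eqP => /mpolyP e; move: hz (e U_(0%R)%MM) (e U_(1%R)%MM).
rewrite /linform !mcoeffB !mcoeffZ !mcoeffXU !mcoeff0 eqxx /= !mulr0 !mulr1.
rewrite subr0 sub0r => hz z1 /eqP; rewrite oppr_eq0 => /eqP z0.
have : z c = 0 by move: c {hz}; apply: ord2_ind.
by rewrite hz => /eqP; rewrite oner_eq0.
Qed.

Lemma divides_sub_reduce c z f : z c = 1 -> divides (linform z) (f - reduce c z f).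
Proof.
move=> hz; apply: (@rmorph_congr _ _ _ (divides (linform z)) idfun) => /=.
- exact: divides0.
- by move=> x y; apply: dividesD.
- by move=> a x; apply: divides_mull.
- by move=> a; rewrite reduceC subrr; apply: divides0.
move=> i; rewrite reduceX; move: c hz i; rewrite /linform.
apply: ord2_ind => hz; apply: ord2_ind; rewrite hz !scale1r ?subrr;
  [exact: divides0| |exact: dividesxx|exact: divides0].
by exists (-1); rewrite mulN1r opprB.
Qed.

Lemma divides_linform c z f : z c = 1 ->
  divides (linform z) f <-> reduce c z f = 0.
Proof.
move=> hz; split=> [[g ->]|h]; first by rewrite rmorphM /= reduce_linform mulr0.
by have := divides_sub_reduce f hz; rewrite h subr0.
Qed.

(** After reduction every variable is a multiple of ['X_c], so all that survives of a form is its
    value at [z]. *)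
Lemma reduce_homog c z e f : f \is e.-homog ->
  reduce c z f = f.@[z] *: 'X_c ^+ e.
Proof.
move=> hf; rewrite /reduce (_ : mmap _ _ f =
    mmap (@mpolyC 2 K) (fun i => 'X_c * (z i)%:MP) f); last first.
  by apply: eq_bigr => m _; congr (_ * _); apply: mmap1_eq => i;
    rewrite mulrC mul_mpolyC.
rewrite (mmap_homogZ _ _ _ hf) mulrC -mul_mpolyC; congr (_ * _).
apply/esym; rewrite /meval /mmap raddf_sum; apply: eq_bigr => m _ /=.
rewrite mpolyCM; congr (_ * _); rewrite /mmap1 rmorph_prod.
by apply: eq_bigr => i _; rewrite rmorphXn.
Qed.

Lemma linform_prime c z f g : z c = 1 ->
  divides (linform z) (f * g) -> divides (linform z) f \/ divides (linform z) g.
Proof.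
move=> hz; rewrite !(divides_linform _ hz) rmorphM /= => /eqP.
by rewrite mulf_eq0 => /orP [] /eqP ->; [left|right].
Qed.

Lemma linform_not_unit z : linform z \isn't a GRing.unit.
Proof.
apply/negP => /unitrP [f [/(congr1 (pihomog mdeg 0)) /eqP + _]].
rewrite (pihomogM_lt _ (linform_homog z)) // pihomog_dE ?dhomog1 //.
by rewrite eq_sym oner_eq0.
Qed.

End LinearForms.

(** The value at [w], the point [(1 : 0)], is the coefficient of degree [e.+1] of the
    dehomogenization. If it is nonzero, that univariate polynomial is not constant and has a
    root. *)
Lemma form_root (K : closedFieldType) e (f : {mpoly K[2]}) :
  f \is e.+1.-homog -> exists c z, z c = 1 /\ f.@[z] = 0.
Proof.
move=> hf; pose w (i : 'I_2) : K := if i == 0 then 1 else 0.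
have [fw|fw] := eqVneq f.@[w] 0; first by exists 0, w; rewrite /w eqxx.
pose h (i : 'I_2) : {poly K} := if i == 0 then 'X else 1.
have hom m : m \in msupp f -> (m 0%R + m 1%R)%N = e.+1.
  by move=> /(dhomog_mf hf) /= <-; rewrite mdegE !big_ord_recl big_ord0 addn0;
    congr (m _ + m _)%N; apply: val_inj.
have hE m : mmap1 h m = 'X^(m 0%R).
  rewrite /mmap1 !big_ord_recl big_ord0 /= /h /= expr1n !mulr1.
  by congr 'X^(m _); apply: val_inj.
have top : (mmap polyC h f)`_e.+1 = f.@[w].
  rewrite /mmap mevalE coef_sum; apply: eq_big_seq => m /hom hm.
  rewrite hE coefCM coefXn !big_ord_recl big_ord0 /= /w /= expr1n mul1r mulr1.
  have -> : lift ord0 ord0 = 1 :> 'I_2 by apply: val_inj.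
  rewrite expr0n; congr (_ * _%:R); apply/eqP/eqP; lia.
have : size (mmap polyC h f) != 1.
  apply: contraNneq fw => sz; rewrite -top nth_default // sz //.
move=> /closed_rootP [x /eqP hx].
exists 1, (fun i => if i == 0 then x else 1); split=> //.
rewrite -hx /mmap mevalE horner_sum; apply: eq_bigr => m _.
rewrite hE hornerM hornerC hornerXn !big_ord_recl big_ord0 /= expr1n !mulr1.
by congr (_ * x ^+ m _); apply: val_inj.
Qed.

Lemma form_ind (K : closedFieldType) (P : {mpoly K[2]} -> Prop) :
  (forall a, a != 0 -> P a%:MP) ->
  (forall c z f, z c = 1 -> P f -> P (linform z * f)) ->
  forall e f, f \is e.-homog -> f != 0 -> P f.
Proof.
move=> PC PL; elim=> [|e IH] f hf f0.
  by move: f0; rewrite (homog0_const hf) mpolyC_eq0; apply: PC.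
have [c [z [hz fz]]] := form_root hf.
have [g eg] : divides (linform z) f.
  by apply/(divides_linform _ hz); rewrite (reduce_homog _ _ hf) fz scale0r.
(* The cofactor is replaced by its component of degree [e], so that the induction applies to a
   form. *)
have eg' : f = linform z * pihomog mdeg e g.
  by rewrite mulrC -(pihomogM _ _ (linform_homog z)) addn1 -eg pihomog_dE.
rewrite eg'; apply: (PL c) => //; apply: IH; first exact: pihomogP.
by apply: contraNneq f0 => h; rewrite eg' h mulr0.
Qed.

(* If [v] has no common linear factor, the linear factors of [f] can be
   removed from [g] one at a time. *)
Lemma form_divides (K : closedFieldType) (I : Type) (v w : I -> {mpoly K[2]})
    (f g : {mpoly K[2]}) e :
  (forall c z, z c = 1 -> exists i, ~ divides (linform z) (v i)) ->
  f \is e.-homog -> f != 0 -> (forall i, f * w i = g * v i) -> divides f g.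
Proof.
move=> hv hf f0; move: e f hf f0 g.
apply: form_ind => [a a0 g _|c z f hz IH g hg].
  by exists (g * (a^-1)%:MP); rewrite -mulrA -mpolyCM mulVf // mulr1.
have [i hi] := hv c z hz.
have [|[g' eg]|//] := @linform_prime _ c z g (v i) hz.
  by rewrite -hg -mulrA; apply: divides_mulr; apply: dividesxx.
rewrite eg mulrC; apply: divides_mul; last exact: dividesxx.
apply: IH => j; apply: (mulfI (linform_neq0 hz)).
by rewrite mulrA hg eg; ring.
Qed.

(** * The Rees algebra and the substitution of F for T *)

Lemma rmorph_mmap (n : nat) (R : nzRingType) (A B : comNzRingType)
    (f : {rmorphism A -> B}) (g : R -> A) (h : 'I_n -> A) (p : {mpoly R[n]}) :
  f (mmap g h p) = mmap (f \o g) (f \o h) p.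
Proof.
rewrite /mmap raddf_sum; apply: eq_bigr => m _ /=.
rewrite rmorphM /mmap1 rmorph_prod; congr (_ * _).
by apply: eq_bigr => i _; rewrite rmorphXn.
Qed.

Lemma divides_mpolyC (D : idomainType) (n : nat) (a : D) (P : {mpoly D[n]}) :
  (forall m, divides a P@_m) -> divides a%:MP P.
Proof.
move=> h; rewrite [P]mpolyE; elim/big_ind: _ => [|x y|m _].
- exact: divides0.
- exact: dividesD.
rewrite -mul_mpolyC; apply: divides_mulr.
by have [x ->] := h m; exists x%:MP; rewrite mpolyCM.
Qed.

Lemma dhomogXn (R : nzRingType) (n : nat) (i : 'I_n) e :
  ('X_i ^+ e : {mpoly R[n]}) \is e.-homog.
Proof.
by rewrite mpolyXn dhomogX /= mdegE (bigD1 i) //= big1 => [|j ne];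
  rewrite mulmnE mnm1E ?eqxx ?mul1n ?addn0 // eq_sym (negbTE ne).
Qed.

Lemma mpolyCX (R : nzRingType) (n : nat) (a : R) e :
  (a ^+ e)%:MP_[n] = a%:MP ^+ e.
Proof. exact: rmorphXn. Qed.

Section Reduction.

Context {K : fieldType}.
Implicit Types P : {mpoly {mpoly K[2]}[3]}.

Definition reduceM c z P := map_mpoly (reduce c z) P.

HB.instance Definition _ c z := GRing.RMorphism.copy (reduceM c z)
  (map_mpoly (reduce c z)).

Lemma mcoeff_reduceM c z P m : (reduceM c z P)@_m = reduce c z P@_m.
Proof. exact: mcoeff_map_mpoly. Qed.

Lemma mcoeff_liftX (f : {mpoly K[3]}) m : (liftX f)@_m = (f@_m)%:MP.
Proof. exact: mcoeff_map_mpoly. Qed.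

Lemma liftXM : {morph @liftX K : f g / f * g}. Proof. exact: rmorphM. Qed.

Lemma divides_sub_reduceM c z P : z c = 1 ->
  divides (linform z)%:MP (P - reduceM c z P).
Proof.
move=> hz; apply: divides_mpolyC => m.
by rewrite mcoeffB mcoeff_reduceM; apply: divides_sub_reduce.
Qed.

Lemma divides_linformM c z P : z c = 1 ->
  divides (linform z)%:MP P <-> reduceM c z P = 0.
Proof.
move=> hz; split=> [[A ->]|h].
  by rewrite rmorphM /= /reduceM map_mpolyC /= reduce_linform mpolyC0 mulr0.
by have := divides_sub_reduceM P hz; rewrite h subr0.
Qed.

Lemma reduceM_homog c z i P : coef_homog i P ->
  reduceM c z P = ('X_c ^+ i)%:MP * liftX (map_mpoly (meval z) P).
Proof.
move=> hP; apply/mpolyP => m; rewrite mcoeff_reduceM mcoeffCM mcoeff_liftX.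
by rewrite (mcoeff_map_mpoly (meval z)) (reduce_homog _ _ (hP m)) -mul_mpolyC mulrC.
Qed.

Lemma coef_homog_liftX (f : {mpoly K[3]}) : coef_homog 0 (liftX f).
Proof.
by move=> m; rewrite mcoeff_liftX -[_%:MP]mulr1 mul_mpolyC rpredZ // dhomog1.
Qed.

Lemma coef_homog_linform z : coef_homog 1 ((linform z : {mpoly K[2]})%:MP_[3]).
Proof. exact: coef_homogC (linform_homog z). Qed.

Lemma coef_homog_decomp c z i P : z c = 1 -> coef_homog i.+1 P ->
  exists A, coef_homog i A /\ P = A * (linform z)%:MP
    + ('X_c ^+ i.+1)%:MP * liftX (map_mpoly (meval z) P).
Proof.
move=> hz hP; have [A eA] := divides_sub_reduceM P hz.
exists (coef_pihomog i A); split; first exact: coef_pihomogP.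
rewrite -(coef_pihomogM _ _ (coef_homog_linform z)) addn1 -eA -reduceM_homog //.
rewrite coef_pihomog_dE ?subrK //; apply: coef_homogD => //.
apply: coef_homogN; rewrite (reduceM_homog _ _ hP).
set b := map_mpoly _ _.
have := coef_homogM (coef_homogC (dhomogXn K c i.+1)) (coef_homog_liftX b).
by rewrite addn0.
Qed.

End Reduction.

Section Rees.

Context {K : fieldType}.
Implicit Types (u : 3.-tuple {mpoly K[2]}) (P : {mpoly {mpoly K[2]}[3]}).

HB.instance Definition _ u := GRing.RMorphism.copy (rees_map u)
  (mmap (@polyC {mpoly K[2]}) (fun i => tnth u i *: 'X)).

(** All [X_i] go to multiples of the new variable, whose exponent thus records the degree in [X].
    This makes the kernel graded in [X] and reduces membership to [P(T, u(T)) = 0]. *)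
Lemma rees_map_homog u j P : P \is j.-homog ->
  rees_map u P = (P.@[tnth u])%:P * 'X^j.
Proof.
move=> hP; rewrite /rees_map (_ : mmap _ _ P =
    mmap (@polyC {mpoly K[2]}) (fun i => 'X * (tnth u i)%:P) P); last first.
  by apply: eq_bigr => m _; congr (_ * _); apply: mmap1_eq => i;
    rewrite mulrC mul_polyC.
rewrite (mmap_homogZ _ _ _ hP) mulrC; congr (_ * _).
by rewrite /meval (rmorph_mmap (@polyC {mpoly K[2]})).
Qed.

Lemma rees_kernel_homog u j P : P \is j.-homog ->
  rees_kernel u P <-> P.@[tnth u] = 0.
Proof.
move=> hP; rewrite /rees_kernel (rees_map_homog _ hP).
split=> [/eqP|->]; last by rewrite mul0r.
by rewrite mulf_eq0 polyC_eq0 expf_eq0 polyX_eq0 andbF orbF => /eqP.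
Qed.

Lemma coef_rees_map u j P : (rees_map u P)`_j = (pihomog mdeg j P).@[tnth u].
Proof.
elim/mpolyind: P => [|c m P _ _ IH].
  by rewrite rmorph0 coef0 pihomog0 meval0.
have -> : rees_map u (c *: 'X_[m] + P) = rees_map u (c *: 'X_[m]) + rees_map u P 
  by exact: rmorphD.
rewrite coefD pihomogD mevalD; congr (_ + _); last exact: IH.
have hX : c *: 'X_[m] \is (mdeg m).-homog by rewrite rpredZ // dhomogX.
rewrite (rees_map_homog _ hX) coefCM coefXn eq_sym.
have [<-|hm] := eqVneq (mdeg m) j; first by rewrite pihomog_dE // mulr1.
by rewrite (pihomog_ne0 _ hX) ?meval0 ?mulr0.
Qed.

Lemma rees_pihomog u j P : rees_kernel u P -> rees_kernel u (pihomog mdeg j P).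
Proof.
move=> hP; apply/(rees_kernel_homog u (pihomogP mdeg j P)).
by rewrite -coef_rees_map hP coef0.
Qed.

(** As the [u_i] share the degree [d], distinct T-degrees stay distinct after evaluation when the
    X-degree is fixed. Hence the kernel is graded in [T] as well. *)
Lemma meval_coef_pihomog u d i j P : forms d u -> P \is j.-homog ->
  (coef_pihomog i P).@[tnth u] = pihomog mdeg (i + d * j) P.@[tnth u].
Proof.
move=> hu hP; pose k := maxn (msize P) (msize (coef_pihomog i P)).
rewrite /meval (mmapE k) ?leq_maxr // (@mmapE _ _ _ _ _ P k) ?leq_maxl //.
rewrite [in RHS]raddf_sum; apply: eq_bigr => m _ /=; rewrite mcoeff_coef_pihomog.
have [hm|/memN_msupp_eq0 ->] := boolP (val m \in msupp P); last first.
  by rewrite pihomog0 !mul0r pihomog0.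
rewrite pihomogM // -(dhomog_mf hP hm) /= mdegE big_distrr /=.
apply: (big_ind2 (fun a e => a \is e.-homog)) => [|a e b f|l _].
- exact: dhomog1.
- exact: dhomogM.
exact: dhomogMn.
Qed.

Lemma rees_coef_pihomog u d i j P : forms d u -> P \is j.-homog ->
  rees_kernel u P -> rees_kernel u (coef_pihomog i P).
Proof.
move=> hu hP /(rees_kernel_homog u hP) e.
apply/(rees_kernel_homog u (coef_pihomog_homog i hP)).
by rewrite (meval_coef_pihomog _ hu hP) e pihomog0.
Qed.

Lemma rees_kernel_mull u a P : rees_kernel u P -> rees_kernel u (a * P).
Proof. by rewrite /rees_kernel rmorphM /= => ->; rewrite mulr0. Qed.

Lemma rees_kernelD u P Q : rees_kernel u P -> rees_kernel u Q ->
  rees_kernel u (P + Q).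
Proof. by rewrite /rees_kernel rmorphD /= => -> ->; rewrite addr0. Qed.

Lemma rees_kernelMC u a P : a != 0 -> rees_kernel u (P * a%:MP) -> rees_kernel u P.
Proof.
rewrite /rees_kernel rmorphM /= {2}/rees_map mmapC => a0 /eqP.
by rewrite mulf_eq0 polyC_eq0 (negbTE a0) orbF => /eqP.
Qed.

End Rees.

Section Substitution.

Context {K : fieldType} (F : 2.-tuple {mpoly K[3]}).

Definition theta (P : {mpoly {mpoly K[2]}[3]}) : {mpoly K[3]} :=
  mmap (comp_mpoly F) (fun i => 'X_i) P.

HB.instance Definition _ := GRing.RMorphism.copy theta
  (mmap (comp_mpoly F) (fun i => 'X_i)).

Lemma thetaD P Q : theta (P + Q) = theta P + theta Q.
Proof. exact: rmorphD. Qed.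

Lemma thetaB P Q : theta (P - Q) = theta P - theta Q.
Proof. exact: rmorphB. Qed.

Lemma thetaM P Q : theta (P * Q) = theta P * theta Q.
Proof. exact: rmorphM. Qed.

Lemma thetaXn n P : theta (P ^+ n) = theta P ^+ n.
Proof. exact: rmorphXn. Qed.

Lemma theta_liftX f : theta (liftX f) = f.
Proof.
move: f; apply: (@eq_rmorph_mpoly _ _ _ (theta \o map_mpoly (@mpolyC 2 K)) idfun)
  => [c|i] /=.
  by rewrite map_mpolyC /theta mmapC; apply: comp_mpolyC.
by rewrite map_mpolyX /theta mmapX mmap1U.
Qed.

Lemma theta_varT i : theta (varT K i) = tnth F i.
Proof. by rewrite /theta mmapC /= (tnth_nth 0); apply: comp_mpolyXU. Qed.

Lemma theta_homog e i j P : forms e F -> P \is j.-homog -> coef_homog i P ->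
  theta P \is (e * i + j).-homog.
Proof.
move=> hF hP hPi; rewrite /theta /mmap; rewrite big_seq.
apply: rpred_sum => m hm; apply: dhomogM.
  rewrite comp_mpolyE big_seq; apply: rpred_sum => m' hm'; apply: rpredZ.
  rewrite -(dhomog_mf (hPi m) hm') /= mdegE big_distrr /=.
  apply: (big_ind2 (fun a e => a \is e.-homog)) => [|a e1 b f|l _].
  - exact: dhomog1.
  - exact: dhomogM.
  exact: dhomogMn.
by rewrite mmap1_id dhomogX (dhomog_mf hP hm).
Qed.

(** Substituting [u] after [F] gives back [T] up to the factor [h], which a form of degree [i] in
    [T] raises to the power [i]. So the image of a kernel element vanishes on the curve. *)
Lemma theta_comp (u : 3.-tuple {mpoly K[2]}) h i P :
  (forall j, tnth F j \mPo u = 'X_j * h) -> coef_homog i P ->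
  theta P \mPo u = h ^+ i * P.@[tnth u].
Proof.
move=> hF hP; rewrite /theta (rmorph_mmap (comp_mpoly u)) /= mevalE mulr_sumr.
rewrite /mmap; apply: eq_bigr => m _ /=; rewrite mulrA; congr (_ * _).
  rewrite /comp_mpoly (rmorph_mmap (comp_mpoly u)) /=.
  transitivity (mmap (@mpolyC 2 K) (fun j => h * 'X_j) P@_m).
    rewrite /mmap; apply: eq_bigr => m' _ /=; rewrite comp_mpolyC; congr (_ * _).
    by apply: mmap1_eq => j /=; rewrite hF mulrC.
  rewrite (mmap_homogZ _ _ _ (hP m)); congr (_ * _).
  by rewrite -[RHS]comp_mpoly_id /comp_mpoly; apply: eq_bigr => m' _;
    congr (_ * _); apply: mmap1_eq => j; rewrite tnth_mktuple.
rewrite /mmap1; apply: eq_bigr => j _ /=.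
by rewrite comp_mpolyXU -tnth_nth.
Qed.

Definition inverse_eq : {mpoly {mpoly K[2]}[3]} :=
  varT K 0 * liftX (tnth F 1) - varT K 1 * liftX (tnth F 0).

Lemma theta_inverse_eq : theta inverse_eq = 0.
Proof.
have thetaMB a b c d : theta (a * b - c * d) = theta a * theta b - theta c * theta d.
  by rewrite thetaB !thetaM.
apply: (etrans (thetaMB _ _ _ _)).
have e := congr2 *%R (theta_varT 0) (theta_liftX (tnth F 1)).
have e' := congr2 *%R (theta_varT 1) (theta_liftX (tnth F 0)).
apply: (etrans (congr2 (fun a b => a - b) e e')).
by rewrite mulrC subrr.
Qed.

(* Modulo [T1 F2 - T2 F1], a form in [T] whose coefficient of [T2 ^ i] is a
   multiple of [F1] is divisible by [T1]. *)
Lemma theta_eq0 i P : (forall b, divides (tnth F 0) (tnth F 1 * b) ->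
    divides (tnth F 0) b) -> tnth F 0 != 0 ->
  coef_homog i P -> theta P = 0 -> divides inverse_eq P.
Proof.
move=> reg F0; have := theta_inverse_eq; rewrite /inverse_eq.
(* The point [(0 : 1)], whose linear form is ['X_0]: dividing by it isolates the pure power of
   T2. *)
pose z (j : 'I_2) : K := (j == 1)%:R.
have hz : z 1 = 1 by [].
have lz : linform z = 'X_0 by rewrite /linform /z scale1r scale0r subr0.
have decomp j Q : coef_homog j.+1 Q -> exists A b, coef_homog j A /\
    Q = A * varT K 0 + varT K 1 ^+ j.+1 * liftX b.
  move=> hQ; have [A [hA]] := coef_homog_decomp hz hQ; rewrite lz mpolyCX => e.
  by exists A, (map_mpoly (meval z) Q).
have base (Q : {mpoly {mpoly K[2]}[3]}) : coef_homog 0 Q -> exists b, Q = liftX b.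
  move=> hQ; exists (map_mpoly (mcoeff 0%MM) Q); apply/mpolyP => m.
  rewrite mcoeff_liftX (mcoeff_map_mpoly (mcoeff 0%MM)); exact: homog0_const.
have hx1 : coef_homog 1 (varT K 1).
  by apply: coef_homogC; rewrite dhomogX /= mdeg1.
have L0 : @liftX K 0 = 0 by exact: raddf0.
have := @coef_homog_liftX K; have := @liftXM K; have := theta_liftX.
move: L0 (theta_varT 0) (theta_varT 1) hx1 base decomp.
move: (varT K 0) (varT K 1) (@liftX K) => x0 x1 L L0 ex0 ex1 hx1 base decomp.
move=> thetaL LM hL; set q := x0 * _ - _ => thetaq.
have q_def : q = x0 * L (tnth F 1) - x1 * L (tnth F 0) by [].
clearbody q; elim: i P => [|i IH] P hP eP.
  have [b eb] := base P hP; suff -> : P = 0 by apply: divides0.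
  by rewrite eb -(thetaL b) -eb eP L0.
have [A [b [hA e]]] := decomp i P hP.
have [b' eb'] : divides (tnth F 0) b.
  have: divides (tnth F 0) (tnth F 1 ^+ i.+1 * b).
    move: eP; rewrite e thetaD !thetaM thetaL thetaXn ex0 ex1 => /eqP.
    rewrite addrC addr_eq0 => /eqP ->; apply: dividesN.
    by apply: divides_mull; apply: dividesxx.
  elim: (i.+1) => [|l IHl]; first by rewrite expr0 mul1r.
  by rewrite exprS -mulrA => /reg.
(* Modulo [q] the product x1 F1 equals x0 F2, so with [b = b' * F1] the remainder becomes a multiple
   of [x0] too. *)
pose A' := A + L b' * x1 ^+ i * L (tnth F 1).
have eP' : P = A' * x0 - L b' * x1 ^+ i * q.
  by rewrite e eb' q_def exprS LM /A'; ring.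
have hA' : coef_homog i A'.
  apply: coef_homogD => //.
  have := coef_homogM (coef_homogM (hL b') (coef_homogX hx1 i)) (hL (tnth F 1)).
  by rewrite add0n mul1n addn0.
clearbody A'.
have eA' : theta A' = 0.
  apply/eqP; move: eP; rewrite eP' thetaB !thetaM thetaq.
  by rewrite mulr0 subr0 ex0 => /eqP; rewrite mulf_eq0 (negbTE F0) orbF.
rewrite eP'; apply: dividesB; last by apply: divides_mull; apply: dividesxx.
by apply: divides_mulr; apply: IH hA' eA'.
Qed.

End Substitution.

(** * The curve and its syzygies *)

Lemma homog_divides_lt (R : idomainType) (n d e : nat) (E f : {mpoly R[n]}) :
  E \is d.-homog -> f \is e.-homog -> divides E f -> (e < d)%N -> f = 0.
Proof.
move=> hE hf [g eg] h; rewrite -(pihomog_dE hf) eg; exact: pihomogM_lt hE h.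
Qed.

Lemma homog_divides_eq (R : idomainType) (n d : nat) (E f : {mpoly R[n]}) :
  E \is d.-homog -> f \is d.-homog -> divides E f -> exists c, f = c *: E.
Proof.
move=> hE hf [g eg]; exists (pihomog mdeg 0 g)@_0%MM.
rewrite -mul_mpolyC -homog0_const ?pihomogP // -(pihomogM _ _ hE) add0n -eg.
by rewrite pihomog_dE.
Qed.

(* Composing [f (u) = 0] with an inverse [G] of [u] gives [f (u (G)) = 0], and
   [u (G)] is proportional to the coordinates modulo [E]. *)
Lemma curve_divides (K : fieldType) (d e : nat) (E f : {mpoly K[3]})
    (u : 3.-tuple {mpoly K[2]}) :
  plane_curve d E -> proper_parameterization E u -> f \is e.-homog ->
  f \mPo u = 0 -> divides E f.
Proof.
move=> [irrE _] [n [G [_ [_ _ [[b hb] _ hU]]]]] hf fu.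
pose U i := tnth u i \mPo G.
have fU : mmap (@mpolyC 3 K) U f = 0.
  rewrite -[0](comp_mpoly0 G) -fu [RHS](rmorph_mmap (comp_mpoly G)) /=.
  by rewrite /mmap; apply: eq_bigr => m _ /=; rewrite comp_mpolyC.
have hUX i j : divides E ('X_j * U i - U j * 'X_i).
  by have := hU i j; rewrite !tnth_mktuple /U mulrC.
(* [f] is evaluated at the families ['X_b * U i] and [U b * 'X_i], which agree modulo [E]: the first
   value is zero, the second is [U b ^+ e * f]. *)
have : divides E (U b ^+ e * f).
  have e0 : mmap (@mpolyC 3 K) (fun i => 'X_b * U i) f = 0.
    by rewrite (mmap_homogZ _ _ _ hf) fU mulr0.
  have e1 : mmap (@mpolyC 3 K) (fun i => U b * 'X_i) f = U b ^+ e * f.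
    rewrite (mmap_homogZ _ _ _ hf); congr (_ * _); rewrite -[RHS]comp_mpoly_id.
    by apply: eq_bigr => m _; congr (_ * _); apply: mmap1_eq => j;
      rewrite tnth_mktuple.
  have : divides E (mmap (@mpolyC 3 K) (fun i => 'X_b * U i) f
      - mmap (@mpolyC 3 K) (fun i => U b * 'X_i) f); last first.
    by rewrite e0 e1 sub0r => /dividesN; rewrite opprK.
  apply: (@rmorph_congr _ _ _ (divides E)) => [|x y|a x|c|i] /=.
  - exact: divides0.
  - exact: dividesD.
  - exact: divides_mull.
  - by rewrite !mmapC subrr; apply: divides0.
  by rewrite !mmapX !mmap1U.
have {hb} hb : ~ divides E (U b) by move: hb; rewrite /U tnth_mktuple.
elim: e {hf} => [|e IH]; first by rewrite expr0 mul1r.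
rewrite exprS -mulrA => /(irreducible_prime (@has_gcds_mpoly K 3) irrE) [] //.
Qed.

(** In F1(u) T2 = F2(u) T1 the prime T1 does not divide T2, hence divides F1(u); the quotient is the
    common factor [h]. *)
Lemma inverse_factor (K : fieldType) (F : 2.-tuple {mpoly K[3]})
    (u : 3.-tuple {mpoly K[2]}) : defines_inverse F u ->
  exists h, h != 0 /\ forall j, tnth F j \mPo u = 'X_j * h.
Proof.
move=> [[i hi] _ hij]; pose v j := tnth F j \mPo u.
have hv : v 0 * 'X_1 = v 1 * 'X_0.
  by apply/eqP; rewrite -subr_eq0; have := hij 0 1;
    rewrite /ideal_line !tnth_mktuple => ->.
have {hi} hi : v i != 0 by apply/eqP; move: hi; rewrite /ideal_line tnth_mktuple.
pose z (j : 'I_2) : K := (j == 1)%:R.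
have hz : z 1 = 1 by [].
have lz : linform z = 'X_0 by rewrite /linform /z scale1r scale0r subr0.
have X0 j : ('X_j : {mpoly K[2]}) != 0 by rewrite -msize_poly_eq0 msizeX.
have [[h eh]|hX] : divides (linform z) (v 0) \/ divides (linform z) 'X_1.
- apply: (linform_prime hz); rewrite hv lz; apply: divides_mull; exact: dividesxx.
- rewrite lz in eh; have e1 : v 1 = h * 'X_1.
    by apply: (mulIf (X0 0)); rewrite -hv eh mulrAC.
  have e j : v j = 'X_j * h by move: j; apply: ord2_ind; rewrite mulrC.
  exists h; split=> //; apply: contraNneq hi => h0; by rewrite e h0 mulr0.
move: hX => /(divides_linform _ hz); rewrite reduceX /z scale1r => /eqP.
by rewrite (negbTE (X0 1)).
Qed.

Lemma homog_not_unit (R : idomainType) (n d : nat) (f : {mpoly R[n]}) :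
  f \is d.+1.-homog -> f \isn't a GRing.unit.
Proof.
move=> hf; apply/negP => uf.
have f1 : divides f 1 by exists f^-1; rewrite mulVr.
have h1 : 1 \is [in R[n], 0.-homog] by apply: dhomog1.
by have /eqP := homog_divides_lt hf h1 f1 isT; rewrite oner_eq0.
Qed.

Section PencilOfConics.

Context {K : fieldType} (F : 2.-tuple {mpoly K[3]}).
Hypotheses (hF : forms 2 F) (hF_gcd : no_common_factor F).

Lemma pencil_neq0 : tnth F 0 != 0.
Proof.
apply/eqP => F0; have /negP [] := homog_not_unit (hF 1).
by apply: hF_gcd; apply: ord2_ind; [rewrite F0; apply: divides0|apply: dividesxx].
Qed.

Lemma pencil_regular b : divides (tnth F 0) (tnth F 1 * b) -> divides (tnth F 0) b.
Proof.
apply: (coprime_divides (@has_gcds_mpoly K 3)) => e h1 h0.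
by apply: hF_gcd; apply: ord2_ind.
Qed.

Lemma inverse_eq_homog : inverse_eq F \is 2.-homog.
Proof.
have hL i : liftX (tnth F i) \is 2.-homog.
  apply/dhomogP => m; rewrite mcoeff_msupp mcoeff_liftX mpolyC_eq0 => hm.
  by apply/eqP; apply: contraNT hm => /(dhomog_nemf_coeff (hF i)) ->.
have hT i : varT K i \is 0.-homog.
  by rewrite /varT -alg_mpolyC; apply: rpredZ; apply: dhomog1.
by apply: rpredB; apply: (dhomogM (hT _) (hL _)).
Qed.

Lemma coef_homog_varT i : coef_homog 1 (varT K i).
Proof. by apply: coef_homogC; rewrite dhomogX /= mdeg1. Qed.

Lemma inverse_eq_coef_homog : coef_homog 1 (inverse_eq F).
Proof.
apply: coef_homogD; last apply: coef_homogN;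
  exact: (coef_homogM (coef_homog_varT _) (coef_homog_liftX _)).
Qed.

Lemma theta_divides i P : coef_homog i P -> theta F P = 0 -> divides (inverse_eq F) P.
Proof. by apply: theta_eq0; [apply: pencil_regular|apply: pencil_neq0]. Qed.

End PencilOfConics.

Section SyzygyForms.

Context {K : fieldType}.
Implicit Types (u : 3.-tuple {mpoly K[2]}) (s : 'rV[{mpoly K[2]}]_3).

Lemma syz_form_homog s : syz_form s \is 1.-homog.
Proof. by apply: rpred_sum => i _; rewrite rpredZ // dhomogX /= mdeg1. Qed.

Lemma mcoeff_syz_form s i : (syz_form s)@_U_(i) = s 0 i.
Proof.
rewrite /syz_form raddf_sum (bigD1 i) //= big1 => [|j hj].
  by rewrite mcoeffZ mcoeffXU eqxx mulr1 addr0.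
by rewrite mcoeffZ mcoeffXU (negbTE hj) mulr0.
Qed.

Lemma syz_form_inj s t : syz_form s = syz_form t -> s = t.
Proof.
move=> e; apply/rowP => i; by rewrite -!mcoeff_syz_form e.
Qed.

Lemma syz_formD s t a b :
  syz_form (a *: s + b *: t) = a%:MP * syz_form s + b%:MP * syz_form t.
Proof.
rewrite /syz_form !mulr_sumr -big_split /=; apply: eq_bigr => i _.
by rewrite !mxE !mul_mpolyC !scalerA scalerDl.
Qed.

Lemma syz_form_coef_homog e s : syz_homog e s -> coef_homog e (syz_form s).
Proof.
move=> hs m; rewrite /syz_form raddf_sum; apply: rpred_sum => i _ /=.
rewrite mcoeffZ mcoeffX; case: eqP => _; last by rewrite mulr0 dhomog0.
rewrite mulr1; exact: hs.
Qed.

Lemma syz_form_eval u s : (syz_form s).@[tnth u] = \sum_i s 0 i * tnth u i.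
Proof.
by rewrite /syz_form raddf_sum; apply: eq_bigr => i _; rewrite /= mevalZ mevalXU.
Qed.

End SyzygyForms.

Section Curve.

Context {K : closedFieldType} {k d : nat} {u : 3.-tuple {mpoly K[2]}}
  {E : {mpoly K[3]}} {F : 2.-tuple {mpoly K[3]}}.
Hypotheses (hdk : d = (2 * k + 1)%N) (hu : forms d u)
  (hu_gcd : no_common_factor u) (hE : plane_curve d E)
  (hproper : proper_parameterization E u)
  (hF : forms 2 F) (hF_gcd : no_common_factor F) (hFu : defines_inverse F u).

Lemma theta_curve i j P : P \is j.-homog -> coef_homog i P ->
  P.@[tnth u] = 0 -> divides E (theta F P).
Proof.
move=> hP hPi eP; have [h [_ hh]] := inverse_factor hFu.
apply: (curve_divides hE hproper (theta_homog hF hP hPi)).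
by rewrite (theta_comp hh hPi) eP mulr0.
Qed.

(** Otherwise [inverse_eq F], of X-degree 2, would divide a nonzero form of X-degree 1. *)
Lemma theta_syz_form_neq0 i s : syz_homog i s -> s != 0 ->
  theta F (syz_form s) != 0.
Proof.
move=> hs s0; apply: contraNneq s0 => h.
have := theta_divides hF hF_gcd (syz_form_coef_homog hs) h.
move=> /(homog_divides_lt (inverse_eq_homog hF) (syz_form_homog s))/(_ isT) e.
apply/eqP; apply: syz_form_inj; rewrite e /syz_form.
by rewrite big1 // => i' _; rewrite mxE scale0r.
Qed.

(** The image of the syzygy is a nonzero multiple of [E] of degree 2i + 1, so 2i + 1 is at least d =
    2k + 1. *)
Lemma syzygy_degree i s : syzygy u s -> syz_homog i s -> s != 0 -> (k <= i)%N.
Proof.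
move=> us hs s0; rewrite leqNgt; apply/negP => hi.
have /negP [] := theta_syz_form_neq0 hs s0; apply/eqP.
have hsf := theta_homog hF (syz_form_homog s) (syz_form_coef_homog hs).
apply: (homog_divides_lt hE.2 hsf); last by lia.
apply: theta_curve (syz_form_homog s) (syz_form_coef_homog hs) _.
by rewrite syz_form_eval.
Qed.

Lemma param_neq0 : exists i, tnth u i != 0.
Proof.
apply/existsP; rewrite -[[exists _, _]]negbK negb_exists; apply/negP => /forallP h.
suff : (0 : {mpoly K[2]}) \is a GRing.unit by rewrite unitr0.
by apply: hu_gcd => i; move: (h i); rewrite negbK => /eqP ->; apply: divides0.
Qed.

Lemma not_divides_all (v : 'I_3 -> {mpoly K[2]}) c z : z c = 1 ->
  ~ (forall i, divides (linform z) (v i)) -> exists i, ~ divides (linform z) (v i).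
Proof.
move=> hz h.
have [/existsP [i hi]|] := boolP [exists i, reduce c z (v i) != 0].
  by exists i => /(divides_linform _ hz)/eqP; apply/negP.
rewrite negb_exists => /forallP h'; case: h => i; apply/(divides_linform _ hz).
by have := h' i; rewrite negbK => /eqP.
Qed.

Lemma param_no_linform c z : z c = 1 -> exists i, ~ divides (linform z) (tnth u i).
Proof.
move=> hz; apply: (@not_divides_all (tnth u) c z hz) => h.
by have /negP [] := linform_not_unit z; apply: hu_gcd.
Qed.

End Curve.

(** * Cross products and Cramer's rule for vectors of length three *)

Section CrossProduct.

Context {A : idomainType}.
Implicit Types p q s : 'rV[A]_3.

Lemma ord3_ind (P : 'I_3 -> Prop) : P 0 -> P 1 -> P 2 -> forall i, P i.
Proof.
move=> P0 P1 P2 [[|[|[|i]]] hi] //.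
- by rewrite (_ : Ordinal hi = 0) //; apply: val_inj.
- by rewrite (_ : Ordinal hi = 1) //; apply: val_inj.
by rewrite (_ : Ordinal hi = 2) //; apply: val_inj.
Qed.

Lemma sum3 (f : 'I_3 -> A) : \sum_i f i = f 0 + f 1 + f 2.
Proof.
by rewrite !big_ord_recl big_ord0 addr0 addrA; congr (f _ + f _ + f _); apply: val_inj.
Qed.

(** Indices are added in ['I_3], that is modulo 3, which accounts for the signs. *)
Definition cross p q (j : 'I_3) :=
  p 0 (j + 1) * q 0 (j + 2) - p 0 (j + 2) * q 0 (j + 1).

Lemma cross_coords p q :
  [/\ cross p q 0 = p 0 1 * q 0 2 - p 0 2 * q 0 1,
      cross p q 1 = p 0 2 * q 0 0 - p 0 0 * q 0 2 &
      cross p q 2 = p 0 0 * q 0 1 - p 0 1 * q 0 0].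
Proof.
by split; rewrite /cross; congr (p 0 _ * q 0 _ - p 0 _ * q 0 _); apply: val_inj.
Qed.

(** The differences are, up to sign, the coordinates of the double product v × (p × q) = (q·v) p -
    (p·v) q. *)
Lemma cross_orthogonal p q (v : 'I_3 -> A) i j :
  \sum_l p 0 l * v l = 0 -> \sum_l q 0 l * v l = 0 ->
  v i * cross p q j = cross p q i * v j.
Proof.
have [c0 c1 c2] := cross_coords p q; rewrite !sum3 => hp hq; apply/eqP.
rewrite -subr_eq0; apply/eqP; move: i j.
have e01 : v 0 * cross p q 1 - cross p q 0 * v 1 = 0.
  transitivity (p 0 2 * (q 0 0 * v 0 + q 0 1 * v 1 + q 0 2 * v 2)
    - q 0 2 * (p 0 0 * v 0 + p 0 1 * v 1 + p 0 2 * v 2)).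
    by rewrite c0 c1; ring.
  by rewrite hp hq !mulr0 subr0.
have e12 : v 1 * cross p q 2 - cross p q 1 * v 2 = 0.
  transitivity (p 0 0 * (q 0 0 * v 0 + q 0 1 * v 1 + q 0 2 * v 2)
    - q 0 0 * (p 0 0 * v 0 + p 0 1 * v 1 + p 0 2 * v 2)).
    by rewrite c1 c2; ring.
  by rewrite hp hq !mulr0 subr0.
have e20 : v 2 * cross p q 0 - cross p q 2 * v 0 = 0.
  transitivity (p 0 1 * (q 0 0 * v 0 + q 0 1 * v 1 + q 0 2 * v 2)
    - q 0 1 * (p 0 0 * v 0 + p 0 1 * v 1 + p 0 2 * v 2)).
    by rewrite c0 c2; ring.
  by rewrite hp hq !mulr0 subr0.
have sym i j : v i * cross p q j - cross p q i * v j = 0 ->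
    v j * cross p q i - cross p q j * v i = 0.
  by move=> e; rewrite mulrC [_ * v i]mulrC -opprB e oppr0.
have diag i : v i * cross p q i - cross p q i * v i = 0 by rewrite mulrC subrr.
by apply: ord3_ind; apply: ord3_ind; do ?[exact: diag | exact: e01 | exact: e12
  | exact: e20 | apply: sym].
Qed.

(* Cramer's rule: three vectors orthogonal to a nonzero vector have zero
   determinant. *)
Lemma cross_cramer p q s (v : 'I_3 -> A) i0 l j : v i0 != 0 ->
  \sum_l p 0 l * v l = 0 -> \sum_l q 0 l * v l = 0 -> \sum_l s 0 l * v l = 0 ->
  cross p q l * s 0 j = cross s q l * p 0 j + cross p s l * q 0 j.
Proof.
have [p0 p1 p2] := cross_coords p q; have [q0 q1 q2] := cross_coords s q.
have [s0 s1 s2] := cross_coords p s; rewrite !sum3 => vi hp hq hs.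
pose D := p 0 0 * (q 0 1 * s 0 2 - q 0 2 * s 0 1)
  + p 0 1 * (q 0 2 * s 0 0 - q 0 0 * s 0 2)
  + p 0 2 * (q 0 0 * s 0 1 - q 0 1 * s 0 0).
have D0 : D = 0.
  apply: (mulfI vi); rewrite mulr0; move: i0 {vi}; apply: ord3_ind.
  - transitivity ((p 0 0 * v 0 + p 0 1 * v 1 + p 0 2 * v 2)
      * (q 0 1 * s 0 2 - q 0 2 * s 0 1)
      + (q 0 0 * v 0 + q 0 1 * v 1 + q 0 2 * v 2)
      * (s 0 1 * p 0 2 - s 0 2 * p 0 1)
      + (s 0 0 * v 0 + s 0 1 * v 1 + s 0 2 * v 2)
      * (p 0 1 * q 0 2 - p 0 2 * q 0 1)); first by rewrite /D; ring.
    by rewrite hp hq hs !mul0r !addr0.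
  - transitivity ((p 0 0 * v 0 + p 0 1 * v 1 + p 0 2 * v 2)
      * (q 0 2 * s 0 0 - q 0 0 * s 0 2)
      + (q 0 0 * v 0 + q 0 1 * v 1 + q 0 2 * v 2)
      * (s 0 2 * p 0 0 - s 0 0 * p 0 2)
      + (s 0 0 * v 0 + s 0 1 * v 1 + s 0 2 * v 2)
      * (p 0 2 * q 0 0 - p 0 0 * q 0 2)); first by rewrite /D; ring.
    by rewrite hp hq hs !mul0r !addr0.
  transitivity ((p 0 0 * v 0 + p 0 1 * v 1 + p 0 2 * v 2)
    * (q 0 0 * s 0 1 - q 0 1 * s 0 0)
    + (q 0 0 * v 0 + q 0 1 * v 1 + q 0 2 * v 2)
    * (s 0 0 * p 0 1 - s 0 1 * p 0 0)
    + (s 0 0 * v 0 + s 0 1 * v 1 + s 0 2 * v 2)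
    * (p 0 0 * q 0 1 - p 0 1 * q 0 0)); first by rewrite /D; ring.
  by rewrite hp hq hs !mul0r !addr0.
apply/eqP; rewrite -subr_eq0; apply/eqP.
(* This is an entry of the product of a matrix with its adjugate: the determinant on the diagonal,
   zero elsewhere. *)
transitivity ((l == j)%:R * D); last by rewrite D0 mulr0.
move: l j; apply: ord3_ind; apply: ord3_ind;
  rewrite ?p0 ?p1 ?p2 ?q0 ?q1 ?q2 ?s0 ?s1 ?s2 /= ?mul1r ?mul0r /D; ring.
Qed.

End CrossProduct.

(** * Existence of a syzygy basis in degrees k and k + 1 *)

Section Existence.

Context {K : closedFieldType} {k d : nat} {u : 3.-tuple {mpoly K[2]}}.
Hypotheses (hdk : d = (2 * k + 1)%N) (hu : forms d u)
  (syz_deg : forall i s, syzygy u s -> syz_homog i s -> s != 0 -> (k <= i)%N).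

Section SyzygySpace.

Variable e : nat.

(** Triples are finite functions into [dhomog], hence a finite-dimensional [K]-space in which
    syzygies of degree [e] can be counted. *)
Definition syz_fun (s : {ffun 'I_3 -> dhomog 2 K e}) : {mpoly K[2]} :=
  \sum_i val (s i) * tnth u i.

Lemma syz_fun_homog s : syz_fun s \is (e + d).-homog.
Proof. by apply: rpred_sum => i _; apply: dhomogM; [apply: valP|apply: hu]. Qed.

Definition syz_map s : dhomog 2 K (e + d) := DHomog (syz_fun_homog s).

Lemma syz_map_is_linear : linear syz_map.
Proof.
move=> a s t; apply: val_inj; rewrite /= /syz_fun scaler_sumr -big_split /=.
by apply: eq_bigr => i _; rewrite !ffunE /= mulrDl scalerAl.
Qed.

HB.instance Definition _ := GRing.isLinear.Build K _ _ _ syz_map syz_map_is_linear.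

Definition syz_space : {vspace {ffun 'I_3 -> dhomog 2 K e}} := lker (linfun syz_map).

Definition syz_row (s : {ffun 'I_3 -> dhomog 2 K e}) : 'rV[{mpoly K[2]}]_3 :=
  \row_i val (s i).

Lemma syz_row_homog s : syz_homog e (syz_row s).
Proof. by move=> l; rewrite mxE; apply: valP. Qed.

Lemma syz_spaceP s : s \in syz_space <-> syzygy u (syz_row s).
Proof.
rewrite memv_ker lfunE /= /syzygy; split=> [/eqP/(congr1 val) /= h|h].
  by rewrite -[RHS]h; apply: eq_bigr => i _; rewrite mxE.
apply/eqP/val_inj; rewrite /= /syz_fun -[RHS]h.
by apply: eq_bigr => i _; rewrite mxE.
Qed.

(** Rank and nullity of [syz_map]: forms of degree [l] in two variables make a space of dimension
    [l.+1]. *)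
Lemma dim_syz_space : (3 * e.+1 <= \dim syz_space + (e + d).+1)%N.
Proof.
have dimV l : dim (dhomog 2 K l) = l.+1.
  by rewrite (_ : dim _ = 'C(l + 1, l)) // addn1 binSn.
have := limg_ker_dim (linfun syz_map) fullv; rewrite capfv -/syz_space dimvf.
rewrite (_ : dim _ = #|'I_3| * dim (dhomog 2 K e))%N // card_ord dimV => <-.
by rewrite leq_add2l (leq_trans (dimvS (subvf _))) // dimvf dimV.
Qed.

End SyzygySpace.

(** In degree k the dimension is at least 3(k + 1) - (3k + 2) = 1. *)
Lemma exists_syzygy : exists p, [/\ syzygy u p, syz_homog k p & p != 0].
Proof.
have h : vpick (syz_space k) != 0.
  rewrite vpick0 -dimv_eq0; have := dim_syz_space k; lia.
exists (syz_row (vpick (syz_space k))); split; last 1 first.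
- apply: contraNneq h => h; apply/eqP/ffunP => i; apply: val_inj.
  by have /rowP/(_ i) := h; rewrite !mxE ffunE.
- exact/syz_spaceP/memv_pick.
exact: syz_row_homog.
Qed.

(** In degree k + 1 the dimension is at least 3(k + 2) - (3k + 3) = 3, while the multiples of [p] by
    linear forms span at most 2 dimensions. *)
Lemma exists_syzygy2 p : syz_homog k p -> exists q,
  [/\ syzygy u q, syz_homog k.+1 q &
      forall a b : K, q <> (a *: 'X_0 + b *: 'X_1) *: p].
Proof.
move=> hp; have hXp j i : 'X_j * p 0 i \is k.+1.-homog.
  by apply: (@dhomogM _ _ _ 1) => //; rewrite dhomogX /= mdeg1.
pose v j : {ffun 'I_3 -> dhomog 2 K k.+1} := [ffun i => DHomog (hXp j i)].
pose X := [:: v 0; v 1].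
have /subvPn [q hq hqv] : ~~ (syz_space k.+1 <= <<X>>)%VS.
  apply/negP => /dimvS h1; have h := leq_trans h1 (dim_span X : _ <= 2)%N.
  by move: (dim_syz_space k.+1) h; move: (\dim _) => n; rewrite hdk; lia.
exists (syz_row q); split; [exact/syz_spaceP|exact: syz_row_homog|].
move=> a b e; case/negP: hqv.
suff -> : q = a *: v 0 + b *: v 1.
  by apply: memvD; apply: memvZ; apply: memv_span; rewrite !inE eqxx ?orbT.
apply/ffunP => i; apply: val_inj; have /rowP/(_ i) := e.
by rewrite !mxE !ffunE /= => ->; rewrite mulrDl -!scalerAl.
Qed.

Lemma linear_form (h : {mpoly K[2]}) : h \is 1.-homog ->
  exists a b : K, h = a *: 'X_0 + b *: 'X_1.
Proof.
move=> hh; pose z (j : 'I_2) : K := (j == 1)%:R; have hz : z 1 = 1 by [].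
have lz : linform z = 'X_0 by rewrite /linform /z scale1r scale0r subr0.
have [g] := divides_sub_reduce h hz; rewrite (reduce_homog _ _ hh) expr1 lz => e.
exists (pihomog mdeg 0 g)@_0%MM, h.@[z].
have hX i : ('X_i : {mpoly K[2]}) \is 1.-homog by exact: (dhomogXn K i 1).
rewrite -mul_mpolyC -homog0_const ?pihomogP // -(pihomogM _ _ (hX 0)).
rewrite -e add0n pihomog_dE ?subrK //; apply: rpredB => //; apply: rpredZ.
exact: hX.
Qed.

(** Both vectors are orthogonal to [u], so their cross product is proportional to [u]; the ratio is
    a polynomial since [u] has no common linear factor. *)
Lemma cross_param p q : (exists i, tnth u i != 0) ->
  (forall c z, z c = 1 -> exists i, ~ divides (linform z) (tnth u i)) ->
  syzygy u p -> syzygy u q -> exists h, forall j, cross p q j = h * tnth u j.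
Proof.
move=> [i ui] hlin hp hq.
have hij j : tnth u i * cross p q j = cross p q i * tnth u j.
  exact: cross_orthogonal hp hq.
have [h eh] := form_divides hlin (hu i) ui hij.
by exists h => j; apply: (mulfI ui); rewrite hij eh; ring.
Qed.

(** Dividing out a common linear factor would leave a nonzero syzygy of degree k - 1, below the
    minimum. *)
Lemma syzygy_no_linform p c z : syzygy u p -> syz_homog k p -> p != 0 ->
  z c = 1 -> exists i, ~ divides (linform z) (p 0 i).
Proof.
move=> hp hpk p0 hz; apply: (@not_divides_all _ (p 0) c z hz) => h.
have k0 : (0 < k)%N.
  rewrite lt0n; apply/negP => /eqP k0; case/negP: p0; apply/eqP/rowP => i.
  rewrite mxE; apply: (homog_divides_lt (linform_homog z) (hpk i) (h i)).
  by rewrite k0.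
have [g hg] := fin_all_exists h.
pose s : 'rV[{mpoly K[2]}]_3 := \row_i pihomog mdeg k.-1 (g i).
have es i : p 0 i = s 0 i * linform z.
  rewrite mxE -(pihomogM _ _ (linform_homog z)) -hg pihomog_dE //.
  by rewrite addn1 prednK.
have hs : syzygy u s.
  rewrite /syzygy; apply: (mulIf (linform_neq0 hz)).
  rewrite mul0r mulr_suml -[RHS]hp.
  by apply: eq_bigr => i _; rewrite es mulrAC.
have hsk : syz_homog k.-1 s by move=> i; rewrite mxE; apply: pihomogP.
have : (k <= k.-1)%N.
  apply: syz_deg hs hsk _; apply: contraNneq p0 => s0.
  by apply/eqP/rowP => i; rewrite es s0 !mxE mul0r.
by rewrite leqNgt prednK // leqnn.
Qed.

(** As in the Hilbert-Burch theorem, p × q = h u, and comparing degrees, k + (k + 1) = d, makes [h]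
    a constant. Once it is nonzero, Cramer's rule has no denominators left and [p], [q] are a
    basis. *)
Lemma exists_syz_basis : (exists i, tnth u i != 0) ->
  (forall c z, z c = 1 -> exists i, ~ divides (linform z) (tnth u i)) ->
  exists p q, [/\ syz_basis u p q, syz_homog k p & syz_homog k.+1 q].
Proof.
move=> u_neq0 u_lin; have [p [hp hpk p0]] := exists_syzygy.
have [q [hq hqk q_span]] := exists_syzygy2 hpk.
have [h eh] := cross_param u_neq0 u_lin hp hq.
have [i0 ui0] := u_neq0.
have /existsP [i hpi] : [exists i, p 0 i != 0].
  rewrite -[[exists _, _]]negbK negb_exists; apply: contra p0 => /forallP p0.
  by apply/eqP/rowP => i; rewrite mxE; apply/eqP; have := p0 i; rewrite negbK.
(* If [h] were zero, [q] would be proportional to [p]; as [p] has no common linear factor, [q] would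
   be a polynomial multiple of it, of degree 1 by homogeneity, against the choice of [q]. *)
have h0 : h != 0.
  apply/eqP => h0.
  have epq j : p 0 i * q 0 j = q 0 i * p 0 j.
    have [c0 c1 c2] := cross_coords p q.
    move: c0 c1 c2; rewrite !eh h0 !mul0r.
    move=> /esym/eqP + /esym/eqP + /esym/eqP; rewrite !subr_eq0.
    move=> /eqP e12 /eqP e20 /eqP e01.
    by move: {hpi} i j; apply: ord3_ind; apply: ord3_ind;
      first [exact: mulrC | rewrite e01 mulrC | rewrite e12 mulrC
        | rewrite e20 mulrC | rewrite -e01 mulrC | rewrite -e12 mulrC
        | rewrite -e20 mulrC].
  have [l el] := form_divides (fun c z => syzygy_no_linform hp hpk p0) (hpk i) hpi epq.
  have eq j : q 0 j = l * p 0 j.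
    by apply: (mulfI hpi); rewrite epq el; ring.
  have [a [b eab]] := linear_form (pihomogP mdeg 1 l).
  apply: (q_span a b); apply/rowP => j; rewrite mxE -eab.
  by rewrite -(pihomogM _ _ (hpk j)) add1n -eq pihomog_dE.
have hc j : cross p q j = h@_0%MM *: tnth u j.
  have hcross : cross p q j \is d.-homog.
    rewrite hdk (_ : (2 * k + 1)%N = (k + k.+1)%N); last by lia.
    by apply: rpredB; apply: dhomogM.
  rewrite -(pihomog_dE hcross) eh -[d]add0n (pihomogM _ _ (hu j)).
  rewrite (homog0_const (pihomogP mdeg 0 h)) mcoeff_pihomog mdeg0 eqxx.
  by rewrite mul_mpolyC.
set c := h@_0%MM in hc.
have c0 : c != 0.
  apply: contraNneq h0 => c0; apply/eqP/(mulIf ui0).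
  by rewrite mul0r -eh hc c0 scale0r.
have cross0 : cross p q i0 != 0 by rewrite hc scaler_eq0 negb_or c0.
exists p, q; split=> //; split=> // [s hs|a b e].
  (* All three cross products in Cramer's rule are multiples of [u], so the coordinate [i0] of [u]
     cancels and only the constant [c] has to be inverted. *)
  have [a ea] := cross_param u_neq0 u_lin hs hq.
  have [b eb] := cross_param u_neq0 u_lin hp hs.
  exists (c^-1 *: a), (c^-1 *: b); apply/rowP => j; apply: (mulfI cross0).
  rewrite (cross_cramer i0 j ui0 hp hq hs) ea eb hc !mxE -!mul_mpolyC.
  have cK : c%:MP * (c^-1)%:MP = 1 :> {mpoly K[2]} by rewrite -mpolyCM mulfV.
  transitivity ((c%:MP * (c^-1)%:MP)
    * (a * tnth u i0 * p 0 j + b * tnth u i0 * q 0 j)).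
    by rewrite cK mul1r.
  ring.
have e' j : a * p 0 j + b * q 0 j = 0.
  by have /rowP/(_ j) := e; rewrite !mxE.
(* Taking the cross product of a p + b q = 0 with [q] leaves a (p × q); with [p] it leaves b (p ×
   q). *)
have ea : a * cross p q i0 = 0.
  transitivity ((a * p 0 (i0 + 1) + b * q 0 (i0 + 1)) * q 0 (i0 + 2)
    - (a * p 0 (i0 + 2) + b * q 0 (i0 + 2)) * q 0 (i0 + 1)).
    by rewrite /cross; ring.
  by rewrite !e' !mul0r subr0.
have eb : b * cross p q i0 = 0.
  transitivity (p 0 (i0 + 1) * (a * p 0 (i0 + 2) + b * q 0 (i0 + 2))
    - p 0 (i0 + 2) * (a * p 0 (i0 + 1) + b * q 0 (i0 + 1))).
    by rewrite /cross; ring.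
  by rewrite !e' !mulr0 subr0.
by split; apply: (mulIf cross0); rewrite mul0r.
Qed.

End Existence.

(** * Generators of the kernel *)

Section NoZeroDivisor.

Context {R : idomainType} {n : nat}.
Implicit Types X Y Z : {mpoly R[n]}.

Lemma mpoly_mul_eq0 X Y : X * Y = 0 -> X = 0 \/ Y = 0.
Proof. by move=> /eqP; rewrite mulf_eq0 => /orP [] /eqP; [left|right]. Qed.

Lemma mpoly_mulIf X Y Z : Z <> 0 -> X * Z = Y * Z -> X = Y.
Proof. by move=> /eqP Z0 /(mulIf Z0). Qed.

End NoZeroDivisor.

Section Ideals.

Context {A : comUnitRingType}.
Implicit Types (s : seq A) (x y a : A).

Lemma ideal_genD s x y : ideal_gen s x -> ideal_gen s y -> ideal_gen s (x + y).
Proof.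
move=> [c ->] [c' ->]; exists (fun i => c i + c' i).
by rewrite -big_split /=; apply: eq_bigr => i _; rewrite mulrDl.
Qed.

Lemma ideal_gen_mull s a x : ideal_gen s x -> ideal_gen s (a * x).
Proof.
move=> [c ->]; exists (fun i => a * c i).
by rewrite mulr_sumr; apply: eq_bigr => i _; rewrite mulrA.
Qed.

Lemma ideal_gen0 s : ideal_gen s 0.
Proof. by exists (fun=> 0); rewrite big1 // => i _; rewrite mul0r. Qed.

Lemma ideal_gen_mem s x : x \in s -> ideal_gen s x.
Proof.
move=> hx; have hi : (index x s < size s)%N by rewrite index_mem.
exists (fun i => (i == Ordinal hi)%:R).
rewrite (bigD1 (Ordinal hi)) //= eqxx mul1r nth_index // big1 ?addr0 // => i hne.
by rewrite (negbTE hne) mul0r.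
Qed.

(** Redundancy is tested by position, not by value. A proper subsequence omits some position, and
    all its members lie in the ideal of the other positions. *)
Lemma minimal_subseq s s' :
  (forall (i0 : 'I_(size s)) c, s`_i0 <> \sum_(i < size s | i != i0) c i * s`_i) ->
  subseq s' s -> (forall x, ideal_gen s' x <-> ideal_gen s x) -> s' = s.
Proof.
move=> hmin /subseqP [m sm es'] hI.
have [/all_pred1P em|] := boolP (all (pred1 true) m).
  by rewrite es' em mask_true // sm.
move=> /allPn [b bm]; rewrite /= eqb_id => /negbTE b0; rewrite {}b0 in bm.
have hi0 : (index false m < size s)%N by rewrite -sm index_mem.
pose I0 x := exists c, x = \sum_(i < size s | i != Ordinal hi0) c i * s`_i.
suff [c] : I0 s`_(Ordinal hi0) by move/hmin.
have I0D x y : I0 x -> I0 y -> I0 (x + y).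
  move=> [c ->] [c' ->]; exists (fun i => c i + c' i).
  by rewrite -big_split /=; apply: eq_bigr => i _; rewrite mulrDl.
have I0M a x : I0 x -> I0 (a * x).
  move=> [c ->]; exists (fun i => a * c i).
  by rewrite mulr_sumr; apply: eq_bigr => i _; rewrite mulrA.
have I0s x : x \in s' -> I0 x.
  (* Elements of [s] might coincide, positions do not: the mask is moved to the list of
     positions. *)
  rewrite es' -{1}(mkseq_nth 0 s) /mkseq -map_mask => /mapP [j].
  rewrite in_mask ?iota_uniq // mem_iota add0n => /andP [/= hj].
  have -> : index j (iota 0 (size s)) = j.
    have := index_uniq 0 (_ : j < size (iota 0 (size s)))%N (iota_uniq 0 (size s)).
    by rewrite nth_iota // size_iota; apply.
  move=> mj ->.
  have hne : Ordinal hj != Ordinal hi0.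
    by apply/eqP => -[e]; move: mj; rewrite e nth_index.
  exists (fun i => (i == Ordinal hj)%:R).
  rewrite (bigD1 (Ordinal hj)) //= eqxx mul1r big1 ?addr0 // => i /andP [_ h].
  by rewrite (negbTE h) mul0r.
have /hI [c ->] : ideal_gen s s`_(Ordinal hi0) by apply: ideal_gen_mem; apply: mem_nth.
apply: (big_ind I0) => [|//|i _]; last by apply/I0M/I0s/mem_nth.
by exists (fun=> 0); rewrite big1 // => i _; rewrite mul0r.
Qed.

End Ideals.

Section Bihomogeneous.

Context {K : fieldType}.
Implicit Types P X Y g c : {mpoly {mpoly K[2]}[3]}.

Lemma bihomogP i j P : bihomog i j P <->
  forall m n, P@_m@_n != 0 -> mdeg m = j /\ mdeg n = i.
Proof.
split=> [[hj hi] m n hmn|h]; split.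
- apply/eqP; apply: contraNT hmn => /(dhomog_nemf_coeff hj) ->.
  by rewrite mcoeff0.
- by apply/eqP; apply: contraNT hmn => /(dhomog_nemf_coeff (hi m)) ->.
- apply/dhomogP => m; rewrite mcoeff_msupp => hm /=.
  have : P@_m@_(mlead P@_m) != 0 by rewrite mleadc_eq0.
  by case/h.
by move=> m; apply/dhomogP => n; rewrite mcoeff_msupp => /h [].
Qed.

Lemma bihomogD i j X Y : bihomog i j X -> bihomog i j Y -> bihomog i j (X + Y).
Proof.
by move=> [hX hXi] [hY hYi]; split; [apply: rpredD|apply: coef_homogD].
Qed.

Lemma bihomogB i j X Y : bihomog i j X -> bihomog i j Y -> bihomog i j (X - Y).
Proof.
by move=> [hX hXi] [hY hYi]; split;
  [apply: rpredB|apply: coef_homogD => //; apply: coef_homogN].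
Qed.

Lemma bihomogM i j i' j' X Y : bihomog i j X -> bihomog i' j' Y ->
  bihomog (i + i') (j + j') (X * Y).
Proof.
by move=> [hX hXi] [hY hYi]; split; [apply: dhomogM|apply: coef_homogM].
Qed.

Lemma mpoly_neq0P P : P != 0 -> exists m n, P@_m@_n != 0.
Proof. by move=> P0; exists (mlead P), (mlead P@_(mlead P)); rewrite !mleadc_eq0. Qed.

Lemma bihomog_uniq i j i' j' P : P != 0 -> bihomog i j P -> bihomog i' j' P ->
  i = i' /\ j = j'.
Proof.
move=> /mpoly_neq0P [m [n hmn]] /bihomogP h /bihomogP h'.
by have [<- <-] := h _ _ hmn; have [-> ->] := h' _ _ hmn.
Qed.

(** A monomial of the nonzero sum occurs in [X] or in [Y], which then has the bidegree of the sum;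
    the other summand is a difference. This fixes the bidegrees of coefficients that are only known
    to be bihomogeneous. *)
Lemma bihomog_split i j i' j' i2 j2 X Y : bihomog i j X -> bihomog i' j' Y ->
  bihomog i2 j2 (X + Y) -> X + Y != 0 -> bihomog i2 j2 X /\ bihomog i2 j2 Y.
Proof.
move=> hX hY hZ /mpoly_neq0P [m [n]]; rewrite !mcoeffD => hmn.
have [hm hn] : mdeg m = j2 /\ mdeg n = i2.
  by apply: (proj1 (bihomogP i2 j2 (X + Y)) hZ); rewrite !mcoeffD.
have [X0|/(proj1 (bihomogP _ _ _) hX) [ej ei]] := eqVneq X@_m@_n 0.
  have Y0 : Y@_m@_n != 0 by move: hmn; rewrite X0 add0r.
  have [ej ei] := proj1 (bihomogP _ _ _) hY _ _ Y0.
  have hY2 : bihomog i2 j2 Y by rewrite -hm -hn ej ei.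
  by split=> //; rewrite -[X](addrK Y); apply: bihomogB.
have hX2 : bihomog i2 j2 X by rewrite -hm -hn ej ei.
by split=> //; rewrite -[Y](addKr X) addrC; apply: bihomogB.
Qed.

Lemma bihomog_divl i j X Y : Y != 0 -> bihomog 1 0 Y -> bihomogeneous X ->
  bihomog i.+1 j (X * Y) -> bihomog i j X.
Proof.
move=> Y0 hY [a [b hX]] hXY; have [->|X0] := eqVneq X 0.
  by apply/bihomogP => m n; rewrite !mcoeff0 eqxx.
have XY0 : X * Y != 0.
  by apply/eqP => /mpoly_mul_eq0 [] /eqP; rewrite (negbTE X0, negbTE Y0).
have [] := bihomog_uniq XY0 hXY (bihomogM hX hY).
by rewrite addn1 addn0 => -[->] ->.
Qed.

Definition bicomp i j P := coef_pihomog i (pihomog mdeg j P).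

Lemma bicomp_dE i j P : bihomog i j P -> bicomp i j P = P.
Proof. by move=> [hj hi]; rewrite /bicomp pihomog_dE // coef_pihomog_dE. Qed.

(** The test guards against truncated subtraction: a factor of larger bidegree contributes
    nothing. *)
Lemma bicompM i j a b c g : bihomog i j g ->
  bicomp a b (c * g) =
    (if (i <= a)%N && (j <= b)%N then bicomp (a - i) (b - j) c else 0) * g.
Proof.
move=> [hj hi]; rewrite /bicomp; case: (leqP j b) => hjb; last first.
  by rewrite andbF mul0r (pihomogM_lt _ hj) // /coef_pihomog raddf0.
rewrite andbT -{1}(subnK hjb) (pihomogM _ _ hj).
case: leqP => hia; last by rewrite mul0r (coef_pihomogM_lt _ hi).
by rewrite -{1}(subnK hia) (coef_pihomogM _ _ hi).
Qed.

Lemma bicomp_sum i j (I : Type) (r : seq I) (Q : pred I) (f : I -> _) :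
  bicomp i j (\sum_(l <- r | Q l) f l) = \sum_(l <- r | Q l) bicomp i j (f l).
Proof.
rewrite /bicomp [pihomog _ _ _]raddf_sum; exact: (raddf_sum (map_mpoly _)).
Qed.

Lemma bicomp_homog i j P : bicomp i j P \is j.-homog.
Proof. by apply: coef_pihomog_homog; apply: pihomogP. Qed.

Lemma coef_pihomog_partition P : exists N, P = \sum_(i < N) coef_pihomog i P.
Proof.
exists (\max_(m <- msupp P) msize P@_m)%N; apply/mpolyP => m.
rewrite raddf_sum /=; under eq_bigr => i _ do rewrite mcoeff_coef_pihomog.
apply: pihomog_partitionE; have [hm|/memN_msupp_eq0 ->] := boolP (m \in msupp P).
  exact: leq_bigmax_seq.
by rewrite mmeasure0.
Qed.

End Bihomogeneous.

Section Span.

Context {A : comNzRingType}.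
Implicit Types (x y z a b c P : A).

Definition span3 x y z P := exists a b c, P = a * x + b * y + c * z.

Lemma span3D x y z P P' : span3 x y z P -> span3 x y z P' -> span3 x y z (P + P').
Proof.
by move=> [a [b [c ->]]] [a' [b' [c' ->]]]; exists (a + a'), (b + b'), (c + c'); ring.
Qed.

Lemma span3M x y z P P' : span3 x y z P -> span3 x y z (P' * P).
Proof.
by move=> [a [b [c ->]]]; exists (P' * a), (P' * b), (P' * c); ring.
Qed.

Lemma span3_first x y z P : (exists a b, P = a * x + b * y) -> span3 x y z P.
Proof. by move=> [a [b ->]]; exists a, b, 0; rewrite mul0r addr0. Qed.

Lemma span3_last x y z P : (exists b c, P = b * y + c * z) -> span3 x y z P.
Proof. by move=> [b [c ->]]; exists 0, b, c; rewrite mul0r add0r. Qed.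

Lemma span3_0 x y z : span3 x y z 0.
Proof. by exists 0, 0, 0; ring. Qed.

Lemma span3_intro x y z a b c : span3 x y z (a * x + b * y + c * z).
Proof. by exists a, b, c. Qed.

(** For [x], [y], [z] of T-degrees 1, k, k + 1 and a product G L of T-degree k + n + 2, the
    coefficients have degrees k + n + 1, n + 2, n + 1. Modulo [L] each is a power of [Y], and
    [Y ^+ n.+1] comes out of all three; what remains is [V], of degree k + 1. *)
Lemma torsion_identity k n (G L x y z Y a b c a0 b0 c0 a1 b1 c1 V : A) :
  V = Y ^+ k * a0 * x + Y * b0 * y + c0 * z ->
  G * L = a * x + b * y + c * z -> a - Y ^+ (k + n.+1) * a0 = a1 * L ->
  b - Y ^+ n.+2 * b0 = b1 * L -> c - Y ^+ n.+1 * c0 = c1 * L ->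
  Y ^+ n.+1 * V = (G - (a1 * x + b1 * y + c1 * z)) * L.
Proof.
move=> -> e ea eb ec.
transitivity (G * L - ((a1 * L) * x + (b1 * L) * y + (c1 * L) * z)); last by ring.
by rewrite e -ea -eb -ec exprD [Y ^+ n.+2]exprS; ring.
Qed.

End Span.

Lemma coef_pihomog_comb (n l : nat) (R : comNzRingType)
    (G L x y z a b c : {mpoly {mpoly R[n]}[l]}) i i' ex ey ez ia ib ic :
  coef_homog i G -> coef_homog i' L ->
  coef_homog ex x -> coef_homog ey y -> coef_homog ez z ->
  (i + i' = ia + ex)%N -> (i + i' = ib + ey)%N -> (i + i' = ic + ez)%N ->
  G * L = a * x + b * y + c * z -> G * L =
    coef_pihomog ia a * x + coef_pihomog ib b * y + coef_pihomog ic c * z.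
Proof.
move=> hG hL hx hy hz ea eb ec e.
have eL : G * L = coef_pihomog (i + i') (a * x + b * y + c * z).
  by rewrite -e (coef_pihomogM _ _ hL) coef_pihomog_dE.
apply: (etrans eL); rewrite !coef_pihomogD.
have hM j p (f g : {mpoly {mpoly R[n]}[l]}) : coef_homog j g ->
    (i + i' = p + j)%N -> coef_pihomog (i + i') (f * g) = coef_pihomog p f * g.
  by move=> hg ->; apply: coef_pihomogM.
by congr (_ + _ + _); apply: hM.
Qed.

Lemma coef_homog_mod (K : fieldType) c z i (P : {mpoly {mpoly K[2]}[3]}) :
  z c = 1 -> coef_homog i P -> exists A b, coef_homog 0 b /\
    P - varT K c ^+ i * b = A * (linform z)%:MP.
Proof.
move=> hz hP; have [A eA] := divides_sub_reduceM P hz.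
exists A, (liftX (map_mpoly (meval z) P)); split; first exact: coef_homog_liftX.
by rewrite -eA (reduceM_homog c z hP) mpolyCX.
Qed.

Section KernelGenerators.

Context {K : closedFieldType} {k d : nat} {u : 3.-tuple {mpoly K[2]}}
  {E : {mpoly K[3]}} {F : 2.-tuple {mpoly K[3]}}.
Hypotheses (hdk : d = (2 * k + 1)%N) (hu : forms d u) (hE : plane_curve d E)
  (hproper : proper_parameterization E u)
  (hF : forms 2 F) (hF_gcd : no_common_factor F) (hFu : defines_inverse F u).
Implicit Types P G : {mpoly {mpoly K[2]}[3]}.

Lemma liftX_bihomog e (f : {mpoly K[3]}) : f \is e.-homog -> bihomog 0 e (liftX f).
Proof.
move=> hf; split; last exact: coef_homog_liftX.
apply/dhomogP => m; rewrite mcoeff_msupp mcoeff_liftX mpolyC_eq0 => hm.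
by apply/eqP; apply: contraNT hm => /(dhomog_nemf_coeff hf) ->.
Qed.

Lemma varT_bihomog i : bihomog 1 0 (varT K i).
Proof.
split; last exact: coef_homog_varT.
by rewrite /varT -alg_mpolyC; apply: rpredZ; apply: dhomog1.
Qed.

Lemma varT_neq0 i : varT K i != 0.
Proof. by rewrite /varT mpolyC_eq0 -msize_poly_eq0 msizeX. Qed.

Lemma inverse_eq_bihomog : bihomog 1 2 (inverse_eq F).
Proof. by split; [apply: inverse_eq_homog|apply: inverse_eq_coef_homog]. Qed.

Lemma liftX_eval (f : {mpoly K[3]}) : (liftX f).@[tnth u] = f \mPo u.
Proof.
rewrite /liftX /map_mpoly (rmorph_mmap (meval (tnth u))) /comp_mpoly.
rewrite /mmap; apply: eq_bigr => m _ /=; rewrite mevalC; congr (_ * _).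
by apply: mmap1_eq => i /=; rewrite mevalXU.
Qed.

Lemma varT_eval i : (varT K i).@[tnth u] = 'X_i.
Proof. exact: mevalC. Qed.

Lemma rees_kernel_inverse_eq : rees_kernel u (inverse_eq F).
Proof.
apply/(rees_kernel_homog u (inverse_eq_homog hF)).
have [h [_ hh]] := inverse_factor hFu.
have eM (a b c e : {mpoly {mpoly K[2]}[3]}) : (a * b - c * e).@[tnth u] =
  a.@[tnth u] * b.@[tnth u] - c.@[tnth u] * e.@[tnth u].
  by rewrite mevalB !mevalM.
apply: (etrans (eM _ _ _ _)).
have e1 := congr2 *%R (varT_eval 0) (etrans (liftX_eval (tnth F 1)) (hh 1)).
have e0 := congr2 *%R (varT_eval 1) (etrans (liftX_eval (tnth F 0)) (hh 0)).
by apply: (etrans (congr2 (fun a b => a - b) e1 e0)); ring.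
Qed.

(** The substitution sends the variables [T] to [F], so it does not distinguish the two
    combinations; and since F(u) = h T, evaluation at [u] only picks up the factor [h]. *)
Lemma elimination_step i j A B :
  bihomogeneous A -> bihomogeneous B ->
  bihomog i.+1 j (A * varT K 0 + B * varT K 1) ->
  A * varT K 0 + B * varT K 1 != 0 ->
  (A * varT K 0 + B * varT K 1).@[tnth u] = 0 ->
  [/\ bihomog i (j + 2) (A * liftX (tnth F 0) + B * liftX (tnth F 1)),
      theta F (A * liftX (tnth F 0) + B * liftX (tnth F 1)) =
        theta F (A * varT K 0 + B * varT K 1) &
      (A * liftX (tnth F 0) + B * liftX (tnth F 1)).@[tnth u] = 0].
Proof.
have [h [_ hh]] := inverse_factor hFu.
move: (liftX_bihomog (hF 0)) (liftX_bihomog (hF 1)) (varT_bihomog 0) (varT_bihomog 1).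
move: (theta_liftX F (tnth F 0)) (theta_liftX F (tnth F 1)).
move: (theta_varT F 0) (theta_varT F 1) (varT_eval 0) (varT_eval 1).
move: (etrans (liftX_eval (tnth F 0)) (hh 0)) (etrans (liftX_eval (tnth F 1)) (hh 1)).
move: (varT_neq0 0) (varT_neq0 1).
move: (varT K 0) (varT K 1) (liftX (tnth F 0)) (liftX (tnth F 1)) => x0 x1 f0 f1.
move=> nx0 nx1 ef0 ef1 tx0 tx1 ex0 ex1 tf0 tf1 hf0 hf1 hx0 hx1 hA hB hP P0 eP.
have [[a1 [a2 hA1]] [b1 [b2 hB1]]] := (hA, hB).
have [hAx hBx] := bihomog_split (bihomogM hA1 hx0) (bihomogM hB1 hx1) hP P0.
have hA' := bihomog_divl nx0 hx0 hA hAx.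
have hB' := bihomog_divl nx1 hx1 hB hBx.
split.
- rewrite -[i]addn0; apply: bihomogD; exact: bihomogM.
- by rewrite !thetaD !thetaM tx0 tx1 tf0 tf1.
move: eP; rewrite !mevalD !mevalM ex0 ex1 ef0 ef1 => eP.
by rewrite !mulrA -mulrDl eP mul0r.
Qed.

Section Basis.

Context {p q : 'rV[{mpoly K[2]}]_3}.
Hypotheses (hpq : syz_basis u p q) (hp : syz_homog k p) (hq : syz_homog k.+1 q).

Notation Sp := (syz_form p).
Notation Sq := (syz_form q).

Lemma basis_neq0 : p != 0.
Proof.
have [_ _ _ /(_ 1 0) h] := hpq; apply/eqP => p0; move: h.
rewrite p0 scaler0 scale0r addr0 => /(_ erefl) [/eqP]; by rewrite oner_eq0.
Qed.

Lemma theta_basis_neq0 : theta F Sp != 0.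
Proof. exact: theta_syz_form_neq0 hp basis_neq0. Qed.

Lemma syz_form_rees s : syzygy u s -> rees_kernel u (syz_form s).
Proof.
move=> hs; apply/(rees_kernel_homog u (syz_form_homog s)).
by rewrite syz_form_eval.
Qed.

Section LowDegree.

Variables (i : nat) (R : {mpoly {mpoly K[2]}[3]}).
Hypotheses (hR : coef_homog i R) (tR : theta F R = theta F Sp).

(* [theta P] vanishes on the curve, hence is a multiple of its equation
   [theta R]. *)
Lemma kernel_low_homog j P : P \is j.-homog -> coef_homog i P -> rees_kernel u P ->
  exists a b, P = a * inverse_eq F + b * R.
Proof.
move=> hP hPi /(rees_kernel_homog u hP) eP.
have [_ hEd] := hE.
have [w ew] := theta_curve hE hproper hF hFu hP hPi eP.
have hSp := theta_homog hF (syz_form_homog p) (syz_form_coef_homog hp).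
have eSp : Sp.@[tnth u] = 0 by rewrite syz_form_eval; have [] := hpq.
have dSp := theta_curve hE hproper hF hFu (syz_form_homog p)
  (syz_form_coef_homog hp) eSp.
(* The image of [Sp] has degree 2k + 1 = d, that of [E], so it is a constant times [E]. *)
rewrite -hdk in hSp; have [c ec] := homog_divides_eq hEd hSp dSp.
have c0 : c != 0.
  by apply: contraNneq theta_basis_neq0 => c0; rewrite ec c0 scale0r.
pose b := liftX (c^-1 *: w); have hb : coef_homog 0 b := coef_homog_liftX _.
have tb : theta F b = c^-1 *: w := theta_liftX _ _.
have h0 : coef_homog i (P - b * R).
  apply: coef_homogD => //; apply: coef_homogN.
  by rewrite -[i]add0n; apply: coef_homogM.
clearbody b; have t0 : theta F (P - b * R) = 0.
  rewrite thetaB thetaM tb tR ew ec -scalerAl -scalerAr scalerA mulVf //.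
  by rewrite scale1r subrr.
have [a ea] := theta_divides hF hF_gcd h0 t0.
by exists a, b; rewrite -ea subrK.
Qed.

Lemma kernel_low P : coef_homog i P -> rees_kernel u P ->
  exists a b, P = a * inverse_eq F + b * R.
Proof.
move=> hPi hP; rewrite [P](pihomog_partitionE (leqnn (msize P))).
move: (inverse_eq F) (fun j => @kernel_low_homog j (pihomog mdeg j P)) => Q low.
elim/big_ind: _ => [|x y [a [b ->]] [a' [b' ->]]|j _].
- by exists 0, 0; rewrite !mul0r addr0.
- by exists (a + a'), (b + b'); ring.
by apply: low; [apply: pihomogP|apply: pihomog_coef_homog|apply: rees_pihomog].
Qed.

End LowDegree.

(* Modulo the linear form [L], forms in [T] are multiples of powers of a second
   linear form [Y]; hence [G L] is [Y ^ n V] up to [L] times the ideal, with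
   [V = W L] in the kernel and [W] in degree [k]. *)
Lemma linform_torsion Q c z i G : coef_homog 1 Q -> rees_kernel u Q ->
  (forall P, coef_homog k P -> rees_kernel u P -> exists a b, P = a * Q + b * Sp) ->
  z c = 1 -> (k <= i)%N -> coef_homog i G -> rees_kernel u G ->
  span3 Q Sp Sq (G * (linform z)%:MP) -> span3 Q Sp Sq G.
Proof.
move=> hQ kQ low hz hki hG kG.
move: hki; rewrite leq_eqVlt => /orP [/eqP ek _|hki].
  by apply: span3_first; apply: low => //; rewrite ek.
move=> [a' [b' [c' e]]].
have [n en] : exists n, i = (k + n.+1)%N by exists (i - k.+1)%N; lia.
have hSp := syz_form_coef_homog hp; have hSq := syz_form_coef_homog hq.
have kSp : rees_kernel u Sp by apply: syz_form_rees; have [] := hpq.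
have kSq : rees_kernel u Sq by apply: syz_form_rees; have [] := hpq.
have hL := @coef_homog_linform K z.
pose a := coef_pihomog (k + n.+1) a'; pose b := coef_pihomog n.+2 b'.
pose g := coef_pihomog n.+1 c'.
have e' : G * (linform z)%:MP = a * Q + b * Sp + g * Sq.
  by apply: (coef_pihomog_comb hG hL hQ hSp hSq _ _ _ e); lia.
have ha : coef_homog (k + n.+1) a by apply: coef_pihomogP.
have hb : coef_homog n.+2 b by apply: coef_pihomogP.
have hg : coef_homog n.+1 g by apply: coef_pihomogP.
have [a1 [a0 [ha0 ea]]] := coef_homog_mod hz ha.
have [b1 [b0 [hb0 eb]]] := coef_homog_mod hz hb.
have [g1 [g0 [hg0 eg]]] := coef_homog_mod hz hg.
have L0 := linform_neq0 hz; have LE := fun P => divides_linformM P hz.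
have Y0 : reduceM c z (varT K c) != 0.
  rewrite /reduceM map_mpolyC /= mpolyC_eq0 reduceX hz scale1r.
  by rewrite -msize_poly_eq0 msizeX.
have hY := @coef_homog_varT K c; move: Y0 ea eb eg e' => Y0.
move: (varT _ c) hY Y0 => Y hY Y0 ea eb eg e'.
have [V defV] : exists V, V = Y ^+ k * a0 * Q + Y * b0 * Sp + g0 * Sq.
  exact: (ex_intro _ _ erefl).
have eV := torsion_identity defV e' ea eb eg.
have hV : coef_homog (k + 1) V.
  have hYk : coef_homog k (Y ^+ k).
    by rewrite -[X in coef_homog X]mul1n; apply: coef_homogX.
  rewrite defV; apply: coef_homogD; first apply: coef_homogD.
  - by have := coef_homogM (coef_homogM hYk ha0) hQ; rewrite addn0.
  - by have := coef_homogM (coef_homogM hY hb0) hSp; rewrite addn0 addnC.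
  by have := coef_homogM hg0 hSq; rewrite add0n addn1.
have kV : rees_kernel u V.
  rewrite defV.
  by apply: rees_kernelD; first apply: rees_kernelD; apply: rees_kernel_mull.
(* [L] divides [Y ^+ n.+1 * V] but not [Y], whose reduction is nonzero; hence it divides [V]. *)
have [W eW] : divides (linform z)%:MP V.
  apply/LE; have : reduceM c z (Y ^+ n.+1 * V) = 0.
    by apply/LE; rewrite eV; eexists.
  have -> : reduceM c z (Y ^+ n.+1 * V) = reduceM c z Y ^+ n.+1 * reduceM c z V.
    by rewrite [LHS]rmorphM /= [X in X * _]rmorphXn.
  move=> /mpoly_mul_eq0 [] // h; exfalso; elim: (n.+1) h => [|l IHl].
    by rewrite expr0 => /eqP; rewrite oner_eq0.
  by rewrite exprS => /mpoly_mul_eq0 [|//] /eqP; apply/negP.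
have L0' : (linform z)%:MP_[3] <> 0 by apply/eqP; rewrite mpolyC_eq0.
have hW : coef_homog k W.
  have eWk : W = coef_pihomog k W.
    apply: (mpoly_mulIf L0'); rewrite -(coef_pihomogM k W hL) -eW.
    by rewrite coef_pihomog_dE.
  by rewrite eWk; apply: coef_pihomogP.
have kW : rees_kernel u W by apply: (rees_kernelMC L0); rewrite -eW.
have -> : G = Y ^+ n.+1 * W + (a1 * Q + b1 * Sp + g1 * Sq).
  apply: (mpoly_mulIf L0'); rewrite mulrDl -mulrA -eW eV -mulrDl; congr (_ * _).
  by rewrite subrK.
apply: span3D; first by apply/span3M/span3_first/low.
exact: (@span3_intro _ Q Sp Sq a1 b1 g1).
Qed.

(** These are the Koszul syzygies of [u], expressed in the basis. *)
Lemma koszul_span b i : exists v w,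
  (tnth u b)%:MP * 'X_i - 'X_b * (tnth u i)%:MP = v * Sp + w * Sq.
Proof.
have [_ _ hspan _] := hpq.
pose e j : 'rV[{mpoly K[2]}]_3 := delta_mx 0 j.
have sume (V : lmodType {mpoly K[2]}) j (f : 'I_3 -> V) : \sum_l e j 0 l *: f l = f j.
  rewrite (bigD1 j) //= big1 => [|l hl]; rewrite mxE eqxx /=.
    by rewrite eqxx scale1r addr0.
  by rewrite (negbTE hl) scale0r.
have hs : syzygy u (tnth u b *: e i + (- tnth u i) *: e b).
  rewrite /syzygy.
  transitivity (tnth u b * (\sum_l e i 0 l * tnth u l)
    - tnth u i * (\sum_l e b 0 l * tnth u l)).
    rewrite !mulr_sumr -sumrB; apply: eq_bigr => l _; rewrite !mxE; ring.
  have sumu j : \sum_l e j 0 l * tnth u l = tnth u j.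
    exact: (sume {mpoly K[2]}^o j (tnth u)).
  by rewrite !sumu mulrC subrr.
have [v [w /(congr1 (@syz_form K)) es]] := hspan _ hs.
rewrite !syz_formD in es; exists v%:MP, w%:MP; apply: etrans es.
have eX j : syz_form (e j) = 'X_j by exact: sume.
by rewrite !eX mpolyCN mulNr ['X_b * _]mulrC.
Qed.

(** Modulo the basis the Koszul relations replace each u_b X_i by X_b u_i. So u_b^j G(X) = G(u_b X)
    becomes X_b^j G(u), which is zero. *)
Lemma kernel_power Q j b G : G \is j.-homog -> rees_kernel u G ->
  span3 Q Sp Sq (G * (tnth u b ^+ j)%:MP).
Proof.
move=> hG /(rees_kernel_homog u hG) eG.
have e1 : mmap (@mpolyC 3 {mpoly K[2]}) (fun i => (tnth u b)%:MP * 'X_i) G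
    = (tnth u b ^+ j)%:MP * G.
  rewrite (mmap_homogZ _ _ _ hG) mpolyCX; congr (_ * _).
  by rewrite -[RHS]comp_mpoly_id; apply: eq_bigr => m _; congr (_ * _);
    apply: mmap1_eq => i; rewrite tnth_mktuple.
have e2 : mmap (@mpolyC 3 {mpoly K[2]}) (fun i => 'X_b * (tnth u i)%:MP) G = 0.
  rewrite (mmap_homogZ _ _ _ hG).
  have -> : mmap (@mpolyC 3 {mpoly K[2]}) (fun i => (tnth u i)%:MP) G
      = (G.@[tnth u])%:MP by rewrite /meval (rmorph_mmap (@mpolyC 3 _)).
  by rewrite eG mpolyC0 mulr0.
suff : span3 Q Sp Sq
    (mmap (@mpolyC 3 {mpoly K[2]}) (fun i => (tnth u b)%:MP * 'X_i) G
    - mmap (@mpolyC 3 {mpoly K[2]}) (fun i => 'X_b * (tnth u i)%:MP) G).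
  by rewrite e1 e2 subr0 mulrC.
apply: (@rmorph_congr _ _ _ (span3 Q Sp Sq)) => [|x y|a x|a|i] /=.
- exact: span3_0.
- exact: span3D.
- exact: span3M.
- by rewrite !mmapC subrr; apply: span3_0.
by rewrite !mmapX !mmap1U; apply/span3_last/koszul_span.
Qed.

(** The linear factors of u_b^j are removed one at a time. [G] and [i] vary in the induction because
    [G] times a linear factor has T-degree [i.+1], which is still at least k. *)
Lemma kernel_high_homog Q i j G : coef_homog 1 Q -> rees_kernel u Q ->
  (forall P, coef_homog k P -> rees_kernel u P -> exists a b, P = a * Q + b * Sp) ->
  (exists b, tnth u b != 0) ->
  (k <= i)%N -> G \is j.-homog -> coef_homog i G -> rees_kernel u G ->
  span3 Q Sp Sq G.
Proof.
move=> hQ kQ low [b ub] hki hGj hG kG.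
have hG' := kernel_power Q b hGj kG.
have hf : tnth u b ^+ j \is (d * j).-homog by apply: dhomogMn; apply: hu.
move: (tnth u b ^+ j) hf (expf_neq0 j ub) hG' => f hf f0.
move: (d * j)%N f hf f0 i G hki hG kG {hGj}.
apply: form_ind => [a a0|c z f hz IH] i G hki hG kG hGf.
  have -> : G = (a^-1)%:MP%:MP * (G * a%:MP%:MP).
    rewrite mulrCA -[X in G * X]mpolyCM -mpolyCM mulVf //.
    by rewrite !mpolyC1 mulr1.
  exact: span3M.
apply: (linform_torsion hQ kQ low hz hki hG kG).
apply: (IH i.+1); first by lia.
- by have := coef_homogM hG (@coef_homog_linform K z); rewrite addn1.
- by rewrite mulrC; apply: rees_kernel_mull.
by rewrite -mulrA -mpolyCM.
Qed.

End Basis.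
End KernelGenerators.

(** * The sequence of the P_i and minimality of the generators *)

Section MinimalGenerators.

Context {K : closedFieldType} {k d : nat} {u : 3.-tuple {mpoly K[2]}}
  {E : {mpoly K[3]}} {F : 2.-tuple {mpoly K[3]}} {p q : 'rV[{mpoly K[2]}]_3}.
Hypotheses (hdk : d = (2 * k + 1)%N) (hk : (1 < k)%N) (hu : forms d u)
  (hE : plane_curve d E) (hproper : proper_parameterization E u)
  (hF : forms 2 F) (hF_gcd : no_common_factor F) (hFu : defines_inverse F u)
  (hpq : syz_basis u p q) (hp : syz_homog k p) (hq : syz_homog k.+1 q).

Lemma syz_form_bihomog i s : syz_homog i s -> bihomog i 1 (@syz_form K s).
Proof. by move=> hs; split; [apply: syz_form_homog|apply: syz_form_coef_homog]. Qed.

Lemma elimination_sequence (P A B : nat -> {mpoly {mpoly K[2]}[3]}) :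
  P k = syz_form p ->
  (forall j, (j < k)%N -> [/\ bihomogeneous (A (k - j)%N), bihomogeneous (B (k - j)%N),
     P (k - j)%N = A (k - j)%N * varT K 0 + B (k - j)%N * varT K 1 &
     P (k - j - 1)%N =
       A (k - j)%N * liftX (tnth F 0) + B (k - j)%N * liftX (tnth F 1)]) ->
  forall i, (i <= k)%N -> [/\ bihomog i (2 * (k - i) + 1) (P i),
    theta F (P i) = theta F (syz_form p) & rees_kernel u (P i)].
Proof.
move=> Pk step.
have t0 := theta_basis_neq0 hF hF_gcd hpq hp.
suff desc j : (j <= k)%N -> [/\ bihomog (k - j) (2 * j + 1) (P (k - j)%N),
    theta F (P (k - j)%N) = theta F (syz_form p) & rees_kernel u (P (k - j)%N)].
  by move=> i hi; have := desc (k - i)%N (leq_subr _ _); rewrite subKn.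
elim: j => [_|j IH hj].
  rewrite subn0 Pk; split=> //; first exact: syz_form_bihomog.
  by apply: syz_form_rees; have [] := hpq.
have [hP tP kP] := IH (ltnW hj); have [hA hB e e'] := step j hj.
have ek : (k - j = (k - j - 1).+1)%N by lia.
have eP : (P (k - j)%N).@[tnth u] = 0 by have [h _] := hP; apply/(rees_kernel_homog u h).
(* The common image is nonzero, so no member of the sequence vanishes; otherwise the bidegrees of
   [A] and [B] would be undetermined. *)
have P0 : P (k - j)%N != 0.
  apply: contraNneq t0 => h; rewrite -tP h; apply/eqP; exact: (mmap0 _ (comp_mpoly F)).
rewrite e in P0 eP hP tP; rewrite [in bihomog _]ek in hP.
have [hP' tP' eP'] := elimination_step hF hFu hA hB hP P0 eP.
rewrite (_ : k - j.+1 = k - j - 1)%N; last by lia.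
rewrite e'; split; last 1 first.
- by have [h _] := hP'; apply/(rees_kernel_homog u h).
- by rewrite (_ : 2 * j.+1 + 1 = 2 * j + 1 + 2)%N; last by lia.
by rewrite tP'.
Qed.

Section Family.

Context {Q : {mpoly {mpoly K[2]}[3]}} {P : nat -> {mpoly {mpoly K[2]}[3]}}.
Hypotheses (hQ : bihomog 1 2 Q) (tQ : theta F Q = 0) (kQ : rees_kernel u Q)
  (Q0 : Q <> 0) (Pk : P k = syz_form p)
  (hP : forall i, (i <= k)%N -> bihomog i (2 * (k - i) + 1) (P i))
  (tP : forall i, (i <= k)%N -> theta F (P i) <> 0)
  (kP : forall i, (i <= k)%N -> rees_kernel u (P i))
  (u0 : exists b, tnth u b != 0)
  (low : forall i j G, (i <= k)%N -> G \is j.-homog -> coef_homog i G ->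
     rees_kernel u G -> exists a b, G = a * Q + b * P i)
  (low_k : forall G, coef_homog k G -> rees_kernel u G ->
     exists a b, G = a * Q + b * syz_form p).

Let s := [:: Q, syz_form q & [seq P i | i <- iota 0 k.+1]].

(** The kernel is bigraded, so an element is treated component by component: T-degree at most k uses
    [Q] and one [P i], larger T-degree uses [Q], [P k] and [q]. *)
Lemma generates x : ideal_gen s x <-> rees_kernel u x.
Proof.
split=> [[c ->]|kx].
  apply: (big_ind (rees_kernel u)) => [|x1 x2|i _].
  - by rewrite /rees_kernel rmorph0.
  - exact: rees_kernelD.
  apply: rees_kernel_mull; have : s`_i \in s by apply: mem_nth.
  rewrite /s in_cons in_cons => /or3P [/eqP ->//|/eqP ->|/mapP [l]].
    by apply: syz_form_rees; have [] := hpq.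
  by rewrite mem_iota => /andP [_ hl] ->; apply: kP.
have sQ : ideal_gen s Q by apply: ideal_gen_mem; rewrite in_cons eqxx.
have sSq : ideal_gen s (syz_form q).
  by apply: ideal_gen_mem; rewrite in_cons in_cons eqxx orbT.
have sP i : (i <= k)%N -> ideal_gen s (P i).
  move=> hi; apply: ideal_gen_mem; rewrite in_cons in_cons; apply/or3P/Or33.
  by apply: map_f; rewrite mem_iota.
have sI (y z a b : {mpoly {mpoly K[2]}[3]}) : ideal_gen s y -> ideal_gen s z ->
    ideal_gen s (a * y + b * z).
  by move=> hy hz; apply: ideal_genD; apply: ideal_gen_mull.
have bihom i j G : G \is j.-homog -> coef_homog i G -> rees_kernel u G ->
    ideal_gen s G.
  move=> hGj hG kG; case: (leqP i k) => hi.
    by have [a [b ->]] := low hi hGj hG kG; apply: sI => //; apply: sP.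
  have [a [b [c ->]]] := kernel_high_homog hdk hu hpq hp hq (proj2 hQ) kQ low_k u0
    (ltnW hi) hGj hG kG.
  apply: ideal_genD; last exact: ideal_gen_mull.
  by apply: sI => //; rewrite -Pk; apply: sP.
rewrite [x](pihomog_partitionE (leqnn (msize x))).
apply: (big_ind (ideal_gen s)) => [|y z|j _]; [exact: ideal_gen0|exact: ideal_genD|].
have hj := pihomogP mdeg j x; have kj := rees_pihomog j kx.
have [N ->] := coef_pihomog_partition (pihomog mdeg j x).
apply: (big_ind (ideal_gen s)) => [|y z|i _]; [exact: ideal_gen0|exact: ideal_genD|].
apply: (bihom i j); first exact: coef_pihomog_homog.
  exact: coef_pihomogP.
exact: rees_coef_pihomog hu hj kj.
Qed.

(** Bidegrees by position in [s]; positions are shifted by two because [Q] and [syz_form q] precede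
    the [P i]. *)
Let degT n := match n with 0 => 1 | 1 => k.+1 | n'.+2 => n' end.
Let degX n := match n with 0 => 2 | 1 => 1 | n'.+2 => (2 * (k - n') + 1)%N end.

Lemma nth_family n : (n <= k)%N -> s`_n.+2 = P n.
Proof.
move=> hn; rewrite -[LHS]/(nth 0 [seq P i | i <- iota 0 k.+1] n).
by rewrite (nth_map 0%N) ?size_iota // nth_iota.
Qed.

Lemma family_bihomog n : (n < size s)%N -> bihomog (degT n) (degX n) s`_n.
Proof.
case: n => [|[|n]] //; first by move=> _; apply: syz_form_bihomog.
rewrite -[size s]/((size [seq P i | i <- iota 0 k.+1]).+2) size_map size_iota => hn.
by rewrite nth_family //; apply: hP.
Qed.

Lemma family_minimal (i0 : 'I_(size s)) c :
  s`_i0 <> \sum_(i < size s | i != i0) c i * s`_i.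
Proof.
move=> /(congr1 (bicomp (degT i0) (degX i0))).
rewrite (bicomp_dE (family_bihomog (ltn_ord i0))) bicomp_sum => e.
have {}e : s`_i0 = \sum_(i < size s | i != i0)
    (if (degT i <= degT i0)%N && (degX i <= degX i0)%N
     then bicomp (degT i0 - degT i) (degX i0 - degX i) (c i) else 0) * s`_i.
  rewrite {1}e; apply: eq_bigr => i _.
  exact: bicompM (family_bihomog (ltn_ord i)).
have size_s : size s = k.+3.
  by rewrite -[LHS]/((size [seq P i | i <- iota 0 k.+1]).+2) size_map size_iota.
have bnd (i : 'I_(size s)) n : val i = n.+2 -> (n <= k)%N.
  by move=> ei; have := ltn_ord i; rewrite -[nat_of_ord i]/(val i) ei size_s !ltnS.
case ei0 : (val i0) => [|[|n]].
(* Bidegree (1, 2): [P l] with l <= 1 has X-degree at least 3 because k > 1, and [q] has T-degree k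
   + 1, so nothing contributes. *)
- have es : s`_i0 = Q := congr1 (nth 0 s) ei0.
  apply: Q0; rewrite -es e big1 // => i hi.
  case: ifP => [|_]; last by rewrite mul0r.
  have : val i != 0 by apply: contraNneq hi => h; apply/eqP/val_inj; rewrite ei0.
  have := bnd i; rewrite -[nat_of_ord i0]/(val i0) -[nat_of_ord i]/(val i) ei0.
  by case: (val i) => [|[|l]] => [//|_ _|/(_ l erefl) hl _] /= /andP []; lia.
(* Bidegree (k + 1, 1): only [P k] has X-degree 1, and [q] as a multiple of [p] contradicts the
   independence of the basis. *)
- have hk2 : (k.+2 < size s)%N by rewrite size_s.
  have hne : Ordinal hk2 != i0 by apply/eqP => /(congr1 val); rewrite ei0.
  move: e; rewrite (bigD1 (Ordinal hk2)) // big1 => [|i /andP [hi hi2]].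
    have -> : s`_i0 = syz_form q := congr1 (nth 0 s) ei0.
    have -> : s`_(Ordinal hk2) = P k by exact: nth_family.
    rewrite -[nat_of_ord i0]/(val i0) ei0 /=.
    rewrite Pk subnn muln0 add0n leqnSn leqnn subSnn subnn /=.
    set b := bicomp _ _ _ => e.
    have hb : b = (b@_0%MM)%:MP by apply/homog0_const/bicomp_homog.
    have [_ _ _ /(_ (- b@_0%MM) 1) h] := hpq.
    have /h [_ /eqP] : - b@_0%MM *: p + 1 *: q = 0.
      apply: syz_form_inj; rewrite syz_formD e mpolyCN mpolyC1 mul1r -hb mulNr.
      by rewrite addr0 addNr /syz_form big1 // => l _; rewrite mxE scale0r.
    by rewrite oner_eq0.
  case: ifP => [|_]; last by rewrite mul0r.
  have h1 : val i != 1%N by apply: contraNneq hi => h; apply/eqP/val_inj; rewrite ei0.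
  have h2 : val i != k.+2 by apply: contraNneq hi2 => h; apply/eqP/val_inj.
  move: h1 h2; have := bnd i.
  rewrite -[nat_of_ord i0]/(val i0) -[nat_of_ord i]/(val i) ei0.
  by case: (val i) => [|[|l]] => [//|//|/(_ l erefl) hl _ hl2] /= /andP []; lia.
(* Bidegree (n, 2(k - n) + 1): the T-degree of [P l] grows with l while its X-degree falls, so no
   other [P l] fits. Only [Q] remains, and its image is zero. *)
have hn := bnd _ _ ei0; apply: (tP hn).
have h0 : (0 < size s)%N by rewrite size_s.
have hne : Ordinal h0 != i0 by apply/eqP => /(congr1 val); rewrite ei0.
have ePn : s`_i0 = P n := etrans (congr1 (nth 0 s) ei0) (nth_family hn).
move: e; rewrite ePn (bigD1 (Ordinal h0)) // big1 => [e|i /andP [hi hi2]].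
  have [b {}e] : exists b, P n = b * Q by eexists; exact: etrans e (addr0 _).
  by rewrite e thetaM tQ mulr0.
case: ifP => [|_]; last by rewrite mul0r.
have h1 : val i != n.+2 by apply: contraNneq hi => h; apply/eqP/val_inj; rewrite ei0.
have h2 : val i != 0 by apply: contraNneq hi2 => h; apply/eqP/val_inj.
move: h1 h2; have := bnd i.
rewrite -[nat_of_ord i0]/(val i0) -[nat_of_ord i]/(val i) ei0.
by case: (val i) => [|[|l]] => [//|_ _ _|/(_ l erefl) hl hl2 _] /= /andP []; lia.
Qed.

Lemma family_minimal_generators : minimal_generators s (rees_kernel u).
Proof.
split=> [|s' hs hI]; first exact: generates.
by apply: (minimal_subseq family_minimal hs) => x; rewrite hI generates.
Qed.

End Family.
End MinimalGenerators.

Lemma inverse_eq_neq0 (K : fieldType) (F : 2.-tuple {mpoly K[3]}) :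
  tnth F 0 != 0 -> inverse_eq F <> 0.
Proof.
rewrite -mleadc_eq0; set m := mlead _ => hm e.
have e' : ((tnth F 1)@_m)%:MP * 'X_0 - ((tnth F 0)@_m)%:MP * 'X_1 = 0 :> {mpoly K[2]}.
  have := congr1 (mcoeff m) e; rewrite mcoeff0 => <-.
  rewrite /inverse_eq mcoeffB; congr (_ - _);
    by apply/esym/(etrans (mcoeffCM _ _ _)); rewrite mcoeff_liftX mulrC.
have := congr1 (mcoeff U_(1%R)%MM) e'; rewrite mcoeffB !mcoeffCM !mcoeffXU /=.
by rewrite mcoeff0 mulr0 mulr1 sub0r => /eqP; rewrite oppr_eq0 (negbTE hm).
Qed.

Theorem theorem5p3 (K : closedFieldType) (k d : nat)
    (u : 3.-tuple {mpoly K[2]}) (E : {mpoly K[3]})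
    (F : 2.-tuple {mpoly K[3]})
    (hdk : d = (2 * k + 1)%N) (hd : (3 < d)%N)
    (hu : forms d u) (hu_gcd : no_common_factor u)
    (hE : plane_curve d E) (hproper : proper_parameterization E u)
    (hconics : parameterizable_by_conics E)
    (hlines : ~ parameterizable_by_lines E)
    (hF : forms 2 F) (hF_gcd : no_common_factor F)
    (hFu : defines_inverse F u) :
  let T1 := varT K 0 in
  let T2 := varT K 1 in
  let F1 := liftX (tnth F 0) in
  let F2 := liftX (tnth F 1) in
  (exists p q : 'rV[{mpoly K[2]}]_3,
     [/\ syz_basis u p q, syz_homog k p & syz_homog k.+1 q]) /\
  (forall p q : 'rV[{mpoly K[2]}]_3,
     syz_basis u p q -> syz_homog k p -> syz_homog k.+1 q ->
     forall P A B : nat -> {mpoly {mpoly K[2]}[3]},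
       P k = syz_form p ->
       (forall j : nat, (j < k)%N ->
          [/\ bihomogeneous (A (k - j)%N), bihomogeneous (B (k - j)%N),
              P (k - j)%N = A (k - j)%N * T1 + B (k - j)%N * T2 &
              P (k - j - 1)%N = A (k - j)%N * F1 + B (k - j)%N * F2]) ->
       minimal_generators
         [:: T1 * F2 - T2 * F1, syz_form q & [seq P i | i <- iota 0 k.+1]]
         (rees_kernel u)).
Proof.
move=> T1 T2 F1 F2; split.
  apply: (exists_syz_basis hdk hu _ (param_neq0 hu_gcd) (param_no_linform hu_gcd)).
  exact: (syzygy_degree hdk hE hproper hF hF_gcd hFu).
move=> p q hpq hp hq P A B Pk step; have hk : (1 < k)%N by lia.
have seqP := elimination_sequence hdk hk hF hF_gcd hFu hpq hp Pk step.
have tp := theta_basis_neq0 hF hF_gcd hpq hp.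
apply: (family_minimal_generators hdk hk hu hpq hp hq (inverse_eq_bihomog hF)
  (theta_inverse_eq F) (rees_kernel_inverse_eq hF hFu)
  (inverse_eq_neq0 (pencil_neq0 hF hF_gcd)) Pk)
  => [i hi|i hi|i hi||i j G hi hGj hG kG|G hG kG].
- by have [] := seqP i hi.
- by have [_ -> _] := seqP i hi; apply/eqP.
- by have [] := seqP i hi.
- exact: param_neq0 hu_gcd.
- have [[_ hPi] tPi _] := seqP i hi.
  exact: (kernel_low_homog hdk hE hproper hF hF_gcd hFu hpq hp hPi tPi hGj hG kG).
exact: (kernel_low hdk hE hproper hF hF_gcd hFu hpq hp
  (syz_form_coef_homog hp) erefl hG kG).
Qed.
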